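(* Let $\phi:\Omega\to\mathbb{R}$ be a continuous potential for which there exists $\alpha>2$ such that $\mathrm{var}_n(\phi)=O(n^{-\alpha})$. Let $\mu_\phi$ be its unique equilibrium state. Then there exists a constant $C>0$ such that for every $n\ge 1$ and every separately $d_\theta$-Lipschitz function $K:\Omega^n\to\mathbb{R}$, $$\int \exp\big(K(x,Tx,\dots,T^{n-1}x)\big)\,d\mu_\phi(x)\le \exp\Big(\int K(x,Tx,\dots,T^{n-1}x)\,d\mu_\phi(x)\Big)\exp\Big(C\sum_{j=0}^{n-1}\mathrm{Lip}_{\theta,j}(K)^2\Big).$$
   Context: $A$ is a finite alphabet, $\mathbb{N}=\{0,1,2,\dots\}$, $\Omega=A^{\mathbb{N}}$ with points $x=x^0x^1x^2\cdots$, and $T:\Omega\to\Omega$ is the shift $(Tx)^k=x^{k+1}$. Fix $\theta\in(0,1)$ and put $d_\theta(x,y)=\theta^{\inf\{k:\,x^k\ne y^k\}}$ (with $d_\theta(x,x)=0$). The variation of $\phi$ is $\mathrm{var}_n(\phi)=\sup\{|\phi(x)-\phi(y)|: x^i=y^i,\ 0\le i\le n-1\}$. The equilibrium state $\mu_\phi$ is the unique shift-invariant Borel probability measure maximizing $\nu\mapsto h(\nu)+\int\phi\,d\nu$ over shift-invariant probability measures, where $h(\nu)$ is the entropy (uniqueness is known for potentials of summable variation). A function $K:\Omega^n\to\mathbb{R}$ is separately $d_\theta$-Lipschitz if for every $i\in\{0,\dots,n-1\}$ there is a constant $\mathrm{Lip}_{\theta,i}(K)$ (taken to be the smallest one) such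 that $|K(x_0,\dots,x_i,\dots,x_{n-1})-K(x_0,\dots,x_i',\dots,x_{n-1})|\le \mathrm{Lip}_{\theta,i}(K)\,d_\theta(x_i,x_i')$ for all points $x_0,\dots,x_{n-1},x_i'\in\Omega$. *)

(* Defs.v *)
From HB Require Import structures.
From mathcomp Require Import all_boot all_order all_algebra.
From mathcomp Require Import all_classical all_reals all_analysis.
Import Order.TTheory GRing.Theory Num.Theory.
Import numFieldNormedType.Exports.

Set Implicit Arguments.
Unset Strict Implicit.
Unset Printing Implicit Defensive.

Local Open Scope classical_set_scope.
Local Open Scope ring_scope.

(* A nonempty alphabet is a [pointedType]; its finiteness is a hypothesis of
   the statement.  The topology is the product of the discrete topologies,
   which is the one induced by every [dtheta] below. *)
Definition Omega (A : pointedType) : Type :=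
  prod_topology (fun _ : nat => discrete_topology A).

HB.instance Definition _ (A : pointedType) := Pointed.on (Omega A).
HB.instance Definition _ (A : pointedType) := Topological.on (Omega A).

(* The measurable sets of [Omega A] are its Borel sets. *)
HB.instance Definition _ (A : pointedType) :=
  Measurable.copy (Omega A) (g_sigma_algebraType (@open (Omega A))).

Definition shift_map (A : pointedType) (x : Omega A) : Omega A := fun k => x k.+1.

Definition dtheta (R : realType) (A : pointedType) (theta : R)
    (x y : Omega A) : R :=
  if pselect (exists k, x k != y k) is left xy then theta ^+ ex_minn xy else 0.

(* For continuous [phi] the set is bounded, [Omega A] being compact, so that
   the real-valued [sup] is the genuine supremum. *)
Definition potential_var (R : realType) (A : pointedType) (phi : Omega A -> R)
    (n : nat) : R :=
  sup [set r | exists x y : Omega A,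
    (forall i, (i < n)%N -> x i = y i) /\ r = `|phi x - phi y|].

Section MeasureEntropy.
Context {R : realType} {d : measure_display} {T : measurableType d}.
Implicit Types (nu : probability T R) (S : T -> T).

Definition invariant_measure S nu : Prop :=
  forall B : set T, measurable B -> nu (S @^-1` B) = nu B.

(* A finite measurable partition is given by a labelling [P : T -> 'I_k] of
   the points by the cells; empty cells contribute [0 * ln 0 = 0] below. *)
Definition measurable_labelling k (P : T -> 'I_k) : Prop :=
  forall c : 'I_k, measurable (P @^-1` [set c]).

(* The cells of the join of the partitions [S^-i P], [0 <= i < n], are indexed
   by the words [w] of length [n]. *)
Definition join_cell S k (P : T -> 'I_k) n (w : {ffun 'I_n -> 'I_k}) : set T :=
  [set x | forall i : 'I_n, P (iter i S x) = w i].

Definition join_entropy S nu k (P : T -> 'I_k) (n : nat) : R :=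
  - \sum_(w : {ffun 'I_n -> 'I_k})
      fine (nu (join_cell S P w)) * ln (fine (nu (join_cell S P w))).

(* By subadditivity the limit exists when [nu] is [S]-invariant. *)
Definition partition_entropy S nu k (P : T -> 'I_k) : R :=
  limn (fun n => join_entropy S nu P n / n%:R).

(* Kolmogorov-Sinai entropy. *)
Definition entropy S nu : \bar R :=
  ereal_sup [set h | exists k (P : T -> 'I_k),
    measurable_labelling P /\ h = (partition_entropy S nu P)%:E].

End MeasureEntropy.

Definition pressure_functional (R : realType) (A : pointedType)
    (phi : Omega A -> R) (nu : probability (Omega A) R) : \bar R :=
  (entropy (@shift_map A) nu + \int[nu]_x (phi x)%:E)%E.

Definition equilibrium_state (R : realType) (A : pointedType)
    (phi : Omega A -> R) (mu : probability (Omega A) R) : Prop :=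
  invariant_measure (@shift_map A) mu /\
  forall nu : probability (Omega A) R, invariant_measure (@shift_map A) nu ->
    (pressure_functional phi nu <= pressure_functional phi mu)%E.

Section SeparatelyLipschitz.
Context {R : realType} {A : pointedType}.
Variables (theta : R) (n : nat) (K : ('I_n -> Omega A) -> R).

(* The condition [0 <= L] only matters for a one-letter alphabet, where
   otherwise every real number would qualify. *)
Definition lipschitz_bounds (i : 'I_n) : set R :=
  [set L | 0 <= L /\ forall u v : 'I_n -> Omega A,
    (forall j, j != i -> u j = v j) ->
    `|K u - K v| <= L * dtheta theta (u i) (v i)].

Definition separately_lipschitz : Prop :=
  forall i : 'I_n, lipschitz_bounds i !=set0.

Definition lipschitz_constant (i : 'I_n) : R := inf (lipschitz_bounds i).

End SeparatelyLipschitz.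

Definition orbit_segment (A : pointedType) (n : nat) (x : Omega A) :
  'I_n -> Omega A := fun i => iter i (@shift_map A) x.

Arguments orbit_segment {A} n x _.

(* Main.v *)
(* Let L be the transfer operator of phi and Z_i = L^i 1.  Since alpha > 2, the
   tails r_n of the series of variations are summable, and the kernels
   g_i(a | y) = exp(phi(a y)) Z_i(a y) / Z_(i+1)(y) have log-variation at most
   2 r_(n+1) over n-cylinders, uniformly in i.  Two copies of a chain with such
   a kernel that differ only in remote letters can be coupled so that their
   disagreements are dominated by the visits to 0 of a transient renewal chain.
   With Hoeffding's martingale argument this gives a Gaussian bound for
   functions of N letters, with a constant independent of N and i.

   It remains to compare mu with these chains.  An ultrafilter limit of
   shift-averaged finite-volume Gibbs measures is an invariant measure obeying
   the upper Gibbs bound, so the maximality of mu gives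
   h(mu) + int phi dmu >= (log Z_n - C) / n for every n.  By the
   Kolmogorov-Sinai theorem the conditional entropy of x_0 given x_1 ... x_M
   under mu is at least h(mu), hence the relative entropies of the conditional
   law of x_0 with respect to g_i telescope when summed over i < n and total at
   most C + n eps_M.  So for suitable M and i they are arbitrarily small, mu is
   almost stationary for g_i, and the Gaussian bound passes to mu. *)
Require Import Defs.
From HB Require Import structures.
From mathcomp Require Import all_boot all_order all_algebra.
From mathcomp Require Import all_classical all_reals all_analysis.
From mathcomp Require Import measurable_realfun ring lra.
Import Order.TTheory GRing.Theory Num.Theory.
Import numFieldNormedType.Exports.

Set Implicit Arguments.
Unset Strict Implicit.
Unset Printing Implicit Defensive.

Local Open Scope classical_set_scope.
Local Open Scope ring_scope.

(** * Concentration for chains with summable memory *)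

(** The obstacle is that [mu] is known only as a maximizer: nothing is given about its conditional
    laws, which are reached through entropies alone. Relative entropy is the link between [mu] and
    the explicit kernels, and it gives smallness on average over [i], never for a prescribed [i].
    This dictates the order of the choices: first the number [N] of letters read by the observable,
    then an error [eps], then a depth [M] and one index [i] for which the conditionings at the
    depths [M], ..., [M + N - 1] are all good. The chain starts from the [mu]-law of [M] letters and
    puts [N] letters in front with the single kernel g_i, so expectations of a bounded observable
    differ from those under [mu] by a multiple of [N * eps]. The error vanishes with [eps] because
    the Gaussian constant depends on none of [N], [M], [i]. Letters are added at the front since the
    transfer operator sums over preimages, that is, prescribes x_0 given its future. Observables of
    infinitely many letters come last, by freezing a remote tail. *)

Section RealInequalities.
Context {R : realType}.
Implicit Types x y t : R.

(** Elementary substitute for Hoeffding's lemma: for a centred variable the linear term has mean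
    zero and only [expR (2 * t ^+ 2)] survives. *)
Lemma expR_le_addexp t : expR t <= t + expR (2 * t ^+ 2).
Proof.
have sq0 : 0 <= t ^+ 2 by exact: sqr_ge0.
have e1 := expR_ge1Dx (2 * t ^+ 2).
have [t2|t2] := leP t (1 / 2); last first.
  have : expR t <= expR (2 * t ^+ 2) by rewrite ler_expR; nra.
  lra.
suff : expR t <= 1 + t + 2 * t ^+ 2 by lra.
have [tm|tm] := leP t (- (1 / 2)).
  have : expR t <= 1 by rewrite -expR0 ler_expR; lra.
  nra.
have eN := expR_ge1Dx (- t).
have t1 : 0 < 1 - t by lra.
have eI : expR t * (1 - t) <= 1.
  rewrite -[leRHS]expR0 -(subrr t) expRD.
  by rewrite ler_wpM2l ?expR_ge0.
rewrite -(ler_pM2r t1); apply: le_trans eI _; nra.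
Qed.

Section FiniteProbability.
Variables (I : finType) (p : I -> R).
Hypotheses (p_ge0 : forall i, 0 <= p i) (p_sum : \sum_i p i = 1).

Lemma mean_le_bound (X : I -> R) c : (forall i, X i <= c) -> \sum_i p i * X i <= c.
Proof.
move=> Xc; rewrite -[leRHS]mul1r -p_sum mulr_suml; apply: ler_sum => i _.
by rewrite ler_wpM2l.
Qed.

(** The mean [m] lies within [c] of every value of [X], so [expR_le_addexp] applies to the centred
    variable [X i - m]. *)
Lemma mgf_osc (X : I -> R) c : (forall i j, X i - X j <= c) ->
  \sum_i p i * expR (X i) <= expR (\sum_i p i * X i + 2 * c ^+ 2).
Proof.
move=> Xc; set m := \sum_i p i * X i.
have Xm i : (X i - m) ^+ 2 <= c ^+ 2.
  have up : X i - m <= c.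
    have -> : X i - m = \sum_j p j * (X i - X j).
      under eq_bigr do rewrite mulrBr.
      by rewrite sumrB -mulr_suml p_sum mul1r.
    by apply: mean_le_bound => k; exact: Xc.
  have dn : m - X i <= c.
    have -> : m - X i = \sum_j p j * (X j - X i).
      under eq_bigr do rewrite mulrBr.
      by rewrite sumrB -mulr_suml p_sum mul1r.
    by apply: mean_le_bound => k; exact: Xc.
  nra.
rewrite expRD.
have -> : \sum_i p i * expR (X i) = expR m * \sum_i p i * expR (X i - m).
  rewrite mulr_sumr; apply: eq_bigr => i _.
  by rewrite mulrCA -expRD addrC subrK.
rewrite ler_wpM2l ?expR_ge0 //.
apply: (@le_trans _ _ (\sum_i p i * ((X i - m) + expR (2 * c ^+ 2)))).
  apply: ler_sum => i _; rewrite ler_wpM2l //.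
  apply: le_trans (expR_le_addexp _) _.
  by rewrite lerD2l ler_expR ler_wpM2l.
under eq_bigr do rewrite mulrDr mulrBr.
by rewrite big_split /= sumrB -!mulr_suml p_sum !mul1r -/m subrr add0r.
Qed.

End FiniteProbability.

End RealInequalities.

(** * Convolution and renewal estimates *)

Section Convolution.
Context {R : realType}.

Lemma sqr_wsum_le (I : finType) (P : pred I) (q x : I -> R) :
  (forall i, 0 <= q i) ->
  (\sum_(i | P i) q i * x i) ^+ 2 <=
  (\sum_(i | P i) q i) * \sum_(i | P i) q i * x i ^+ 2.
Proof.
move=> q0; rewrite -subr_ge0.
suff -> : (\sum_(i | P i) q i) * (\sum_(i | P i) q i * x i ^+ 2) -
    (\sum_(i | P i) q i * x i) ^+ 2 =
    \sum_(i | P i) \sum_(j | P j) 2^-1 * (q i * q j * (x i - x j) ^+ 2).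
  by apply: sumr_ge0 => i _; apply: sumr_ge0 => j _;
    rewrite mulr_ge0 ?invr_ge0 ?ler0n // mulr_ge0 ?sqr_ge0 // mulr_ge0.
transitivity (\sum_(i | P i) \sum_(j | P j)
   (2^-1 * (q i * q j * x j ^+ 2) + 2^-1 * (q i * q j * x i ^+ 2)
    - (q i * x i) * (q j * x j))); last first.
  by apply: eq_bigr => i _; apply: eq_bigr => j _; field.
under [RHS]eq_bigr do rewrite sumrB big_split /=.
rewrite [RHS]sumrB big_split /= expr2; congr (_ - _); last first.
  by rewrite mulr_suml; apply: eq_bigr => i _; rewrite mulr_sumr.
rewrite [X in _ + X]exchange_big /= -big_split /= mulr_suml.
apply: eq_bigr => i _; rewrite -big_split mulr_sumr; apply: eq_bigr => j _ /=.
by field.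
Qed.

Definition causal_conv (q delta : nat -> R) (i : nat) : R :=
  \sum_(k < i.+1) q (i - k)%N * delta k.

(** Young's inequality for convolutions: Cauchy-Schwarz in the inner sum, then exchange of
    summation. It serves both for the renewal sequence and for the powers of [theta]. *)
Lemma sum_conv_sqr_le (q delta : nat -> R) D N : (forall s, 0 <= q s) ->
  (forall S, \sum_(s < S) q s <= D) ->
  \sum_(i < N) causal_conv q delta i ^+ 2 <= D ^+ 2 * \sum_(k < N) delta k ^+ 2.
Proof.
move=> q0 qD.
have D0 : 0 <= D by have := qD 0%N; rewrite big_ord0.
apply: (@le_trans _ _ (\sum_(i < N) D * \sum_(k < i.+1) q (i - k)%N * delta k ^+ 2)).
  apply: ler_sum => i _.
  apply: le_trans (sqr_wsum_le _ _ _) _; first by move=> k; exact: q0.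
  rewrite ler_wpM2r //; first by apply: sumr_ge0 => k _; rewrite mulr_ge0 ?sqr_ge0.
  rewrite (reindex_inj rev_ord_inj) /=; apply: le_trans (qD i.+1).
  by apply: ler_sum => k _; rewrite subSS subKn // -ltnS.
rewrite -mulr_sumr expr2 -mulrA ler_wpM2l //.
have -> : \sum_(i < N) \sum_(k < i.+1) q (i - k)%N * delta k ^+ 2 =
    \sum_(i < N) \sum_(k < N | (k <= i)%N) q (i - k)%N * delta k ^+ 2.
  apply: eq_bigr => i _.
  by rewrite (big_ord_widen_cond N xpredT
    (fun k => q (i - k)%N * delta k ^+ 2)) //.
rewrite (exchange_big_dep xpredT) //= mulr_sumr; apply: ler_sum => k _.
rewrite -mulr_suml ler_wpM2r ?sqr_ge0 //.
apply: le_trans (qD (N - k)%N).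
have -> : \sum_(i < N | (k <= i)%N) q (i - k)%N = \sum_(k <= i < N) q (i - k)%N.
  by rewrite big_geq_mkord.
rewrite -(big_mkord xpredT q).
rewrite -{1}[X in \sum_(X <= _ < _) _]add0n big_addn.
by apply: ler_sum => i _; rewrite addnK.
Qed.

(* [renewal rho l s] is the probability that a chain on [nat] started at [l],
   which climbs from [m] to [m.+1] with probability [rho m] and otherwise falls
   to [0], is at [0] at time [s]. *)
Fixpoint renewal (rho : nat -> R) (l s : nat) : R :=
  if s is s'.+1 then
    rho l * renewal rho l.+1 s' + (1 - rho l) * renewal rho 0 s'
  else (l == 0%N)%:R.

Variables rho survive : nat -> R.
Hypotheses (rho_ge0 : forall l, 0 <= rho l) (rho_le1 : forall l, rho l <= 1).

Lemma renewal_ge0 l s : 0 <= renewal rho l s.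
Proof.
elim: s l => [|s IH] l /=; first exact: ler0n.
by rewrite addr_ge0 // mulr_ge0 // subr_ge0.
Qed.

(* [survive l] is a lower bound for the probability of never visiting [0] after
   leaving [l], so the number of visits is dominated by a geometric variable. *)
Lemma sum_renewal_le S : (forall l, 0 < survive l <= 1) ->
  (forall l, survive l <= rho l * survive l.+1) ->
  \sum_(s < S) renewal rho 0 s <= (survive 0)^-1.
Proof.
move=> s01 sS.
have s0 : 0 < survive 0 by case/andP: (s01 0%N).
(* Generalize to any starting point: a chain leaving [l] returns to [0] with probability at most
   [1 - survive l], and a return brings at most [(survive 0)^-1] expected visits. *)
suff H l : \sum_(s < S) renewal rho l s <=
    (l == 0%N)%:R + (1 - survive l) / survive 0.
  apply: le_trans (H 0%N) _.
  by rewrite eqxx mulrBl divff ?gt_eqF // mulr1n addrC subrK div1r.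
elim: S l => [|S IH] l.
  rewrite big_ord0 addr_ge0 // divr_ge0 //; last exact: ltW.
  by rewrite subr_ge0; case/andP: (s01 l).
rewrite big_ord_recl /= lerD2l big_split /= -!mulr_sumr.
have := IH l.+1; have := IH 0%N; rewrite eqxx /= add0r => h0 h1.
have rl := rho_ge0 l; have rl1 : 0 <= 1 - rho l by rewrite subr_ge0.
apply: le_trans (lerD (ler_wpM2l rl h1) (ler_wpM2l rl1 h0)) _.
have -> : 1 + (1 - survive 0) / survive 0 = (survive 0)^-1.
  by rewrite mulrBl divff ?gt_eqF // addrC subrK div1r.
have i0 : 0 <= (survive 0)^-1 by rewrite invr_ge0 ltW.
have : 0 <= (survive 0)^-1 * (rho l * survive l.+1 - survive l).
  by rewrite mulr_ge0 // subr_ge0.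
set i := (survive 0)^-1; nra.
Qed.

End Convolution.

(** * Coupling and concentration for a chain that prepends letters *)

Section KernelConcentration.
Context {R : realType} {A : pointedType} {I : finType}.
Variable d : I -> A.
Implicit Types (y u v : Omega A) (f F : Omega A -> R).

Definition push (a : A) (y : Omega A) : Omega A :=
  fun k => if k is k'.+1 then y k' else a.

Definition agree (l : nat) u v := forall i, (i < l)%N -> u i = v i.

Lemma agree_push l a u v : agree l u v -> agree l.+1 (push a u) (push a v).
Proof. by move=> uv [|i] // il; exact: uv. Qed.

(** [p] splits into [rho * q], on which both chains draw the same letter, and a remainder of mass
    [1 - rho], paired independently with [q]. *)
Lemma coupling_le (p q X Y : I -> R) rho b1 b2 :
  (forall i, 0 <= q i) -> \sum_i p i = 1 -> \sum_i q i = 1 ->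
  0 <= rho -> (forall i, rho * q i <= p i) ->
  (forall i, X i - Y i <= b1) -> (forall i j, X i - Y j <= b2) ->
  \sum_i p i * X i - \sum_i q i * Y i <= rho * b1 + (1 - rho) * b2.
Proof.
move=> q0 p1 q1 rho0 pq b1P b2P.
have -> : \sum_i p i * X i - \sum_i q i * Y i =
    rho * (\sum_i q i * (X i - Y i)) +
    \sum_i (p i - rho * q i) * (\sum_j q j * (X i - Y j)).
  have XY i : \sum_j q j * (X i - Y j) = X i - \sum_j q j * Y j.
    under eq_bigr do rewrite mulrBr.
    by rewrite sumrB -mulr_suml q1 mul1r.
  under [X in _ = _ + X]eq_bigr do rewrite XY mulrBr mulrBl.
  rewrite !sumrB -mulr_suml sumrB p1 -mulr_sumr q1.
  have -> : \sum_i q i * (X i - Y i) = \sum_i q i * X i - \sum_i q i * Y i.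
    by rewrite -sumrB; apply: eq_bigr => i _; rewrite mulrBr.
  have -> : \sum_i rho * q i * X i = rho * \sum_i q i * X i.
    by rewrite mulr_sumr; apply: eq_bigr => i _; rewrite mulrA.
  by ring.
apply: lerD; first by rewrite ler_wpM2l //; exact: mean_le_bound.
have -> : (1 - rho) * b2 = \sum_i (p i - rho * q i) * b2.
  by rewrite -mulr_suml sumrB p1 -mulr_sumr q1 mulr1.
apply: ler_sum => i _; rewrite ler_wpM2l ?subr_ge0 //.
by apply: mean_le_bound => // j.
Qed.

Variables (g : I -> Omega A -> R) (rho survive : nat -> R).
Hypotheses (g_ge0 : forall a y, 0 <= g a y) (g_sum : forall y, \sum_a g a y = 1).
Hypothesis rho01 : forall l, 0 <= rho l <= 1.
Hypothesis g_agree : forall l a u v, agree l u v -> rho l * g a v <= g a u.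
Hypothesis survive01 : forall l, 0 < survive l <= 1.
Hypothesis survive_rho : forall l, survive l <= rho l * survive l.+1.

(** Markov operator of the chain; after [i] steps the letter [y k] sits at position [i + k], and the
    letters drawn occupy the positions below [i], the earliest one last. *)
Definition kstep f : Omega A -> R := fun y => \sum_a g a y * f (push (d a) y).

Variables (N : nat) (F : Omega A -> R) (delta : nat -> R).
Hypothesis delta_ge0 : forall k, 0 <= delta k.
Hypothesis F_delta : forall u v,
  F u - F v <= \sum_(k < N) delta k * (u k != v k)%:R.

Let q := renewal rho.

Let rho_ge0 l : 0 <= rho l. Proof. by case/andP: (rho01 l). Qed.
Let rho_le1 l : rho l <= 1. Proof. by case/andP: (rho01 l). Qed.

(* Couple the two chains step by step: after [l] agreements they
   split with probability at most [1 - rho l]. *)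
Lemma kstep_iter_osc i l u v : (i <= N)%N -> agree l u v ->
  iter i kstep F u - iter i kstep F v <=
  \sum_(k < i) q l (i - k)%N * delta k +
  \sum_(k < N - i) delta (i + k)%N * (u k != v k)%:R.
Proof.
elim: i l u v => [|i IH] l u v iN uv.
  by rewrite big_ord0 add0r; apply: le_trans (F_delta u v) _; rewrite subn0.
rewrite /= {1 2}/kstep.
set rest := (X in _ <= _ + X).
have iN' := ltnW iN.
have NiE : (N - i = (N - i.+1).+1)%N by rewrite subnSK.
have restE a b : \sum_(k < N - i) delta (i + k)%N * (push a u k != push b v k)%:R
    = delta i * (a != b)%:R + rest.
  rewrite NiE big_ord_recl addn0 /=; congr (_ + _).
  by apply: eq_bigr => k _; rewrite /bump /= add1n addnS.
(* [b1] is for equal letters, with one more agreement; [b2] for different ones, where the agreement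
   restarts from [0] and the new disagreement costs [delta i]. *)
apply: (le_trans (coupling_le (b1 := \sum_(k < i) q l.+1 (i - k)%N * delta k + rest)
   (b2 := \sum_(k < i) q 0%N (i - k)%N * delta k + (delta i + rest))
   _ (g_sum u) (g_sum v) (rho_ge0 l) _ _ _)) => //.
- by move=> a; exact: g_agree.
- move=> a; apply: le_trans (IH l.+1 _ _ iN' _) _; first exact: agree_push.
  by rewrite restE eqxx mulr0 add0r.
- move=> a b; apply: le_trans (IH 0%N _ _ iN' _) _; first by [].
  rewrite restE lerD2l lerD2r -[leRHS]mulr1 ler_wpM2l //.
  by case: (_ != _) => //; exact: ler01.
rewrite big_ord_recr /= subSnn.
under [X in _ <= X + _ + _]eq_bigr => k _ do
  rewrite subSn 1?ltnW //= mulrDl -!mulrA.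
rewrite big_split /= -!mulr_sumr.
have -> : q l 1 = (1 - rho l).
  by rewrite /q /= mulr1 mulr0 add0r.
by rewrite le_eqVlt; apply/orP; left; apply/eqP; ring.
Qed.

(** Martingale method: given [y], the next letter moves the conditional mean by at most
    [causal_conv (q 0%N) delta i], and [mgf_osc] adds twice its square to the exponent. *)
Lemma kstep_iter_mgf i y : (i <= N)%N ->
  iter i kstep (expR \o F) y <=
  expR (iter i kstep F y + 2 * \sum_(j < i) causal_conv (q 0%N) delta j ^+ 2).
Proof.
elim: i y => [|i IH] y iN; first by rewrite big_ord0 mulr0 addr0.
rewrite iterS {1}/kstep.
set c := \sum_(j < i) causal_conv (q 0%N) delta j ^+ 2.
apply: (@le_trans _ _ (\sum_a g a y * (expR (iter i kstep F (push (d a) y))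
   * expR (2 * c)))).
  apply: ler_sum => a _; rewrite ler_wpM2l // -expRD; apply: IH; exact: ltnW.
under eq_bigr do rewrite mulrA.
rewrite -mulr_suml.
have osc a b : iter i kstep F (push (d a) y) - iter i kstep F (push (d b) y)
    <= causal_conv (q 0%N) delta i.
  apply: le_trans (kstep_iter_osc (l := 0) (ltnW iN) _) _; first by [].
  rewrite /causal_conv big_ord_recr /= lerD2l subnn.
  have -> : (N - i = (N - i.+1).+1)%N by rewrite subnSK.
  rewrite big_ord_recl big1 ?addr0 //=; last first.
    by move=> k _; rewrite eqxx mulr0.
  rewrite addn0 mul1r -[leRHS]mulr1 ler_wpM2l //.
  by case: (_ != _) => //; exact: ler01.
apply: le_trans (ler_wpM2r (expR_ge0 _)
  (mgf_osc (g_ge0 ^~ y) (g_sum y) osc)) _.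
by rewrite -expRD ler_expR big_ord_recr /= mulrDr addrA addrAC -/c.
Qed.

(** The random starting point [z w] counts as one further draw, hence [N.+1] terms; Young's
    inequality, with renewal mass at most [(survive 0)^-1], sums the squares. *)
Lemma mixture_mgf (W : finType) (p : W -> R) (z : W -> Omega A) :
  (forall w, 0 <= p w) -> \sum_w p w = 1 ->
  \sum_w p w * iter N kstep (expR \o F) (z w) <=
  expR (\sum_w p w * iter N kstep F (z w) +
        2 * (survive 0 ^- 2 * \sum_(k < N.+1) delta k ^+ 2)).
Proof.
move=> p0 p1.
have osc a b : iter N kstep F (z a) - iter N kstep F (z b)
    <= causal_conv (q 0%N) delta N.
  apply: le_trans (kstep_iter_osc (l := 0) (leqnn N) _) _; first by [].
  by rewrite subnn big_ord0 addr0 /causal_conv big_ord_recr /= lerDl subnn mul1r.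
apply: (@le_trans _ _ (\sum_w p w * (expR (iter N kstep F (z w)) *
    expR (2 * \sum_(j < N) causal_conv (q 0%N) delta j ^+ 2)))).
  by apply: ler_sum => w _; rewrite ler_wpM2l // -expRD; exact: kstep_iter_mgf.
under eq_bigr do rewrite mulrA.
rewrite -mulr_suml; apply: le_trans (ler_wpM2r (expR_ge0 _)
  (mgf_osc p0 p1 osc)) _.
rewrite -expRD ler_expR -addrA lerD2l -mulrDr ler_wpM2l // addrC.
rewrite -(big_ord_recr N (fun i => causal_conv (q 0%N) delta i ^+ 2)) -exprVn.
apply: sum_conv_sqr_le => [s|S]; first exact: renewal_ge0.
exact: sum_renewal_le.
Qed.

End KernelConcentration.

(** * Words and transfer operators *)

(** Nested pairs make an itinerary of length [n.+1] convertible to the pair of its first label and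
    the shifted itinerary, the shape in which conditional entropies occur. *)
Fixpoint word (K : finType) (n : nat) : finType :=
  if n is m.+1 then ((K * word K m)%type : finType) else unit.

Fixpoint itin (X : Type) (K : finType) (S : X -> X) (P : X -> K) (n : nat)
    (x : X) : word K n :=
  if n is m.+1 then (P x, itin S P m (S x)) else tt.

Section Words.
Context {A : pointedType} {I : finType}.
Variables (d : I -> A) (e : A -> I).
Implicit Types (x y u v : Omega A).

Fixpoint glue (n : nat) : word I n -> Omega A -> Omega A :=
  if n is m.+1 then fun w y => push (d w.1) (glue w.2 y) else fun _ y => y.

Definition letter0 x : I := e (x 0%N).
Definition code (n : nat) x : word I n := itin (@shift_map A) letter0 n x.

Lemma agree_glue_push n (w : word I n) l u v :
  agree l u v -> agree (n + l) (glue w u) (glue w v).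
Proof.
elim: n w l u v => [|n IH] w l u v uv //=; rewrite addSn.
by apply: agree_push; exact: IH.
Qed.

Lemma agree_glue n (w : word I n) u v : agree n (glue w u) (glue w v).
Proof. by rewrite -[n in agree n]addn0; exact: agree_glue_push. Qed.

Lemma code_push n a y : code n.+1 (push a y) = (e a, code n y).
Proof. by []. Qed.

Hypotheses (de : cancel d e) (ed : cancel e d).

Lemma agree_glue_code n x y : agree n x (glue (code n x) y).
Proof.
elim: n x => [|n IH] x // [|i] /= i_lt; first by rewrite ed.
exact: (IH (shift_map x)).
Qed.

Lemma code_agree n u v : agree n u v -> code n u = code n v.
Proof.
elim: n u v => [|n IH] u v //= uv; congr (_, _).
  by rewrite /letter0 uv.
by apply: IH => i i_n; exact: uv.
Qed.

End Words.

Lemma sum_word_S (R : realType) (K : finType) n (f : word K n.+1 -> R) :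
  \sum_w f w = \sum_(a : K) \sum_(w : word K n) f (a, w).
Proof. by rewrite pair_bigA /=; apply: eq_bigr => -[]. Qed.

Section TransferOperator.
Context {R : realType} {A : pointedType} {I : finType}.
Variables (d : I -> A) (e : A -> I) (phi : Omega A -> R) (rem tl : nat -> R).
Hypotheses (de : cancel d e) (ed : cancel e d).
(* [rem n] bounds the sum of the variations of order at least [n], and [tl n]
   the sum of the [rem m] for [m >= n]: the telescoping form avoids series. *)
Hypothesis phi_rem : forall n u v, agree n u v -> phi u - phi v <= rem n - rem n.+1.
Hypothesis rem_ge0 : forall n, 0 <= rem n.
Hypothesis rem_tl : forall n, rem n <= tl n - tl n.+1.
Hypothesis tl_ge0 : forall n, 0 <= tl n.
Implicit Types (f h : Omega A -> R) (y u v : Omega A).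

Lemma rem_noninc n : rem n.+1 <= rem n.
Proof. by rewrite -subr_ge0 -(subrr (phi point)); exact: phi_rem. Qed.

Definition transfer f : Omega A -> R :=
  fun y => \sum_a expR (phi (push (d a) y)) * f (push (d a) y).

Definition pfun i : Omega A -> R := iter i transfer (fun=> 1).

Lemma iter_transfer_le i f h y : (forall x, f x <= h x) ->
  iter i transfer f y <= iter i transfer h y.
Proof.
move=> fh; elim: i y => [|i IH] y //=.
by apply: ler_sum => a _; rewrite ler_wpM2l ?expR_ge0.
Qed.

Lemma iter_transferZ i c f y :
  iter i transfer (fun x => c * f x) y = c * iter i transfer f y.
Proof.
elim: i y => [|i IH] y //=; rewrite /transfer mulr_sumr.
by apply: eq_bigr => a _; rewrite mulrCA IH.
Qed.

Lemma iter_transferD i f h y :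
  iter i transfer (fun x => f x + h x) y = iter i transfer f y + iter i transfer h y.
Proof.
elim: i y => [|i IH] y //=; rewrite /transfer -big_split /=.
by apply: eq_bigr => a _; rewrite -mulrDr IH.
Qed.

Lemma iter_transfer_ext i f h y : f =1 h -> iter i transfer f y = iter i transfer h y.
Proof. by move=> /funext ->. Qed.

Lemma iter_transfer_shift s f h y :
  iter s transfer (fun x => h (iter s (@shift_map A) x) * f x) y =
  h y * iter s transfer f y.
Proof.
elim: s y h => [|s IH] y h //=.
rewrite /transfer mulr_sumr; apply: eq_bigr => a _.
by rewrite -[in RHS]mulrCA -(IH _ (h \o @shift_map A)).
Qed.

Lemma pfun_gt0 i y : 0 < pfun i y.
Proof.
elim: i y => [|i IH] y; first exact: ltr01.
rewrite /pfun /= /transfer (bigD1 (e point)) //=.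
apply: ltr_wpDr; last by rewrite mulr_gt0 ?expR_gt0 //; exact: IH.
by apply: sumr_ge0 => a _; rewrite mulr_ge0 ?expR_ge0 // ltW //; exact: IH.
Qed.

Lemma pfun_ge0 i y : 0 <= pfun i y.
Proof. exact/ltW/pfun_gt0. Qed.

(** Bounded distortion, uniform in [i]: each preimage step lengthens the agreement by one letter,
    and the variations paid telescope to [rem l.+1 - rem (l.+1 + i)]. *)
Lemma pfun_agree i l u v : agree l u v -> pfun i u <= expR (rem l.+1) * pfun i v.
Proof.
move=> uv; suff : pfun i u <= expR (rem l.+1 - rem (l.+1 + i)%N) * pfun i v.
  move=> /le_trans; apply; rewrite ler_wpM2r ?ler_expR ?pfun_ge0 //.
  by rewrite gerBl.
elim: i l u v uv => [|i IH] l u v uv; first by rewrite addn0 subrr expR0 mul1r.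
rewrite /pfun /= /transfer mulr_sumr; apply: ler_sum => a _.
have auv := agree_push (d a) uv.
apply: le_trans (ler_wpM2l (expR_ge0 _) (IH _ _ _ auv)) _.
rewrite !mulrA -!expRD ler_wpM2r ?pfun_ge0 // ler_expR addSnnS.
by have := phi_rem auv; lra.
Qed.

Lemma pfun_le i u v : pfun i u <= expR (rem 1%N) * pfun i v.
Proof. exact: pfun_agree. Qed.

Lemma ln_pfun_agree i l u v : agree l u v -> ln (pfun i u) - ln (pfun i v) <= rem l.+1.
Proof.
move=> uv; rewrite lerBlDr -[rem _]expRK -lnM ?posrE ?expR_gt0 ?pfun_gt0 //.
by rewrite ler_ln ?posrE ?mulr_gt0 ?expR_gt0 ?pfun_gt0 //; exact: pfun_agree.
Qed.

Lemma pfunD_ge m n y : expR (- rem 1%N) * (pfun m y * pfun n y) <= pfun (m + n) y.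
Proof.
rewrite /pfun iterD -/(pfun n) mulrA mulrAC -iter_transferZ.
under iter_transfer_ext do rewrite mulr1.
apply: iter_transfer_le => x.
by rewrite expRN ler_pdivrMl ?expR_gt0 //; exact: pfun_le.
Qed.

Lemma ln_pfun_mul k n y :
  k%:R * (ln (pfun n y) - rem 1%N) <= ln (pfun (k * n) y).
Proof.
elim: k => [|k IH]; first by rewrite mul0r mul0n /pfun /= ln1.
rewrite mulSn; have := pfunD_ge n (k * n) y.
rewrite -ler_ln ?posrE ?mulr_gt0 ?expR_gt0 ?pfun_gt0 //.
rewrite !lnM ?posrE ?mulr_gt0 ?expR_gt0 ?pfun_gt0 // expRK.
apply: le_trans; rewrite -natr1 mulrDl mul1r; lra.
Qed.

(* Law of the letter put in front of [y] under the finite-volume Gibbs measure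
   on [i.+1] letters; its regularity in [y] is uniform in [i], so that no
   eigenfunction of the transfer operator is needed. *)
Definition gker i (a : I) y : R :=
  expR (phi (push (d a) y)) * pfun i (push (d a) y) / pfun i.+1 y.

Lemma gker_gt0 i a y : 0 < gker i a y.
Proof. by rewrite divr_gt0 ?mulr_gt0 ?expR_gt0 ?pfun_gt0. Qed.

Lemma gker_sum i y : \sum_a gker i a y = 1.
Proof. by rewrite -mulr_suml divff // gt_eqF //; exact: (pfun_gt0 i.+1). Qed.

Lemma ln_gker i a y :
  ln (gker i a y) = phi (push (d a) y) + ln (pfun i (push (d a) y)) - ln (pfun i.+1 y).
Proof.
by rewrite ln_div ?lnM ?posrE ?mulr_gt0 ?expR_gt0 ?pfun_gt0 // expRK.
Qed.

(** One [rem l.+1] bounds the numerator of [gker], where the variation of [phi] and the distortion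
    of [pfun i] telescope; the other bounds the denominator. *)
Definition gker_rho l : R := expR (- (2 * rem l.+1)).
(** Lower bound for the infinite product of the [gker_rho m] with [m >= l]. It exists because the
    tails [rem] are themselves summable, with sums controlled by [tl]. *)
Definition gker_survive l : R := expR (- (2 * tl l)).

Lemma gker_agree i l a u v : agree l u v -> gker_rho l * gker i a v <= gker i a u.
Proof.
move=> uv; rewrite /gker_rho -ler_ln ?posrE ?mulr_gt0 ?invr_gt0 ?expR_gt0 ?pfun_gt0 //.
rewrite lnM ?posrE ?expR_gt0 ?gker_gt0 // expRK !ln_gker.
have vu : agree l v u by move=> k kl; rewrite uv.
have avu := agree_push (d a) vu.
have := phi_rem avu; have := ln_pfun_agree i avu; have := ln_pfun_agree i.+1 uv.
lra.
Qed.

Lemma gker_rho01 l : 0 <= gker_rho l <= 1.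
Proof. by rewrite expR_ge0 -expR0 ler_expR oppr_le0 mulr_ge0. Qed.

Lemma gker_survive01 l : 0 < gker_survive l <= 1.
Proof. by rewrite expR_gt0 -expR0 ler_expR oppr_le0 mulr_ge0. Qed.

Lemma gker_survive_rho l : gker_survive l <= gker_rho l * gker_survive l.+1.
Proof.
rewrite -expRD ler_expR; have := rem_tl l; have := rem_noninc l; lra.
Qed.

(** Birkhoff sum of [phi] of length [n] at the point [w] followed by [y]. *)
Fixpoint wsum n : word I n -> Omega A -> R :=
  if n is m.+1 then
    fun w y => phi (push (d w.1) (glue d w.2 y)) + wsum w.2 y
  else fun _ _ => 0.

Lemma wsum_le n (w : word I n) u v : wsum w u - wsum w v <= rem 1%N.
Proof.
suff : wsum w u - wsum w v <= rem 1%N - rem n.+1.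
  by move=> /le_trans; apply; rewrite gerBl.
elim: n w => [|n IH] w; first by rewrite subrr subrr.
have := IH w.2; have := phi_rem (agree_glue d (n := n.+1) w u v).
rewrite /=; lra.
Qed.

(** Exactly one of the preimages of order [n] of [y] has the code [w]. *)
Lemma iter_transfer_code n (w : word I n) f y :
  iter n transfer (fun x => (code e n x == w)%:R * f x) y =
  expR (wsum w y) * f (glue d w y).
Proof.
elim: n w f => [|n IH] w f /=; first by case: w; rewrite expR0.
rewrite -iterS iterSr.
have E : transfer (fun x => (code e n.+1 x == w)%:R * f x) =1
    fun x => (code e n x == w.2)%:R * (expR (phi (push (d w.1) x)) * f (push (d w.1) x)).
  move=> x; rewrite /transfer (bigD1 w.1) //= big1 ?addr0.
    case: w => a w /=; rewrite code_push de xpair_eqE eqxx /=.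
    by rewrite mulrCA.
  move=> b bw; case: w bw => a w /= bw.
  by rewrite code_push de xpair_eqE (negbTE bw) /= mul0r mulr0.
by rewrite (iter_transfer_ext _ _ E) IH mulrA -expRD addrC.
Qed.

(* Upper Gibbs bound: the interior cylinder [w], preceded by [s] free letters
   and followed by [k] free ones. *)
Lemma iter_transfer_cylinder_le k j s (w : word I j) y :
  iter (k + (j + s)) transfer
    (fun x => (code e j (iter s (@shift_map A) x) == w)%:R) y <=
  expR (4 * rem 1%N) * (expR (wsum w y) / pfun j y) * pfun (k + (j + s)) y.
Proof.
set c := rem 1%N.
have Zs x : pfun s x <= expR c * pfun s y by exact: pfun_le.
(* The [s] free letters give [pfun s] and the word its Birkhoff sum; making both independent of the
   point costs two of the four factors [expR c]. *)
have step1 x : iter (j + s) transfer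
    (fun x => (code e j (iter s (@shift_map A) x) == w)%:R) x <=
    (expR c * pfun s y) * (expR c * expR (wsum w y)).
  rewrite iterD.
  have E : iter s transfer (fun x => (code e j (iter s (@shift_map A) x) == w)%:R)
      =1 fun x => (code e j x == w)%:R * pfun s x.
    move=> z; rewrite -(iter_transfer_shift s (fun=> 1)
      (fun x => (code e j x == w)%:R)).
    by apply: iter_transfer_ext => u; rewrite mulr1.
  rewrite (iter_transfer_ext _ _ E) iter_transfer_code mulrC.
  apply: ler_pM; rewrite ?expR_ge0 ?pfun_ge0 //.
  by rewrite -expRD ler_expR -lerBlDr; exact: wsum_le.
rewrite iterD; apply: le_trans (iter_transfer_le _ _ step1) _.
set C := (X in iter _ _ (fun=> X)).
have -> : iter k transfer (fun=> C) y = C * pfun k y.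
  by rewrite -iter_transferZ; apply: iter_transfer_ext => u; rewrite mulr1.
have C0 : 0 <= C by rewrite !mulr_ge0 ?expR_ge0 ?pfun_ge0.
(* The other two factors come from recombining [pfun k], [pfun j] and [pfun s] into one partition
   function. *)
have Z1 := pfunD_ge j s y; have Z2 := pfunD_ge k (j + s) y.
have {}Z2 : expR (- c) * (pfun k y * (expR (- c) * (pfun j y * pfun s y)))
    <= pfun (k + (j + s)) y.
  apply: le_trans Z2; rewrite ler_wpM2l ?expR_ge0 // ler_wpM2l ?pfun_ge0 //.
apply: le_trans (ler_wpM2l _ Z2); last first.
  by rewrite !mulr_ge0 ?expR_ge0 // invr_ge0 ltW // pfun_gt0.
have -> : 4 * c = (c + c) + (c + c) by ring.
rewrite /C !expRD !expRN.
have := lt0r_neq0 (pfun_gt0 j y); have := lt0r_neq0 (expR_gt0 c).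
move=> h1 h2; rewrite le_eqVlt; apply/orP; left; apply/eqP.
by field; apply/andP.
Qed.

End TransferOperator.

(** * Entropy of finite labellings *)

(** Nonnegativity of relative entropy: [ln t <= t - 1] at [t = q a / p a]. *)
Lemma gibbs_inequality (R : realType) (K : finType) (p q : K -> R) :
  (forall a, 0 <= p a) -> (forall a, 0 <= q a) ->
  (forall a, 0 < p a -> 0 < q a) -> \sum_a q a <= \sum_a p a ->
  - \sum_a p a * ln (p a) <= - \sum_a p a * ln (q a).
Proof.
move=> p0 q0 pq qp; rewrite lerN2 -subr_le0 -sumrB.
apply: (@le_trans _ _ (\sum_a (q a - p a))); last first.
  by rewrite sumrB subr_le0.
apply: ler_sum => a _.
have := p0 a; rewrite le_eqVlt => /orP[/eqP <-|pa]; first by rewrite !mul0r !subr0.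
have qa := pq _ pa.
have -> : p a * ln (q a) - p a * ln (p a) = p a * ln (1 + (q a / p a - 1)).
  by rewrite [1 + _]addrC subrK ln_div ?posrE // mulrBr.
have -> : q a - p a = p a * (q a / p a - 1).
  by rewrite mulrBr mulr1 mulrCA divff ?mulr1 // gt_eqF.
rewrite ler_pM2l //; apply: le_ln1Dx.
by rewrite ltrBrDr addNr divr_gt0.
Qed.

Section FiniteEntropy.
Context {R : realType} {disp : measure_display} {T : measurableType disp}.
Variable nu : probability T R.
Implicit Types (K J L : finType).

Definition mlab K (X : T -> K) := forall a, measurable (X @^-1` [set a]).
Definition pr K (X : T -> K) (a : K) : R := fine (nu (X @^-1` [set a])).
Definition ent K (X : T -> K) : R := - \sum_a pr X a * ln (pr X a).

Lemma mlab_set K (X : T -> K) (P : pred K) : mlab X -> measurable [set x | P (X x)].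
Proof.
move=> mX; have -> : [set x | P (X x)] = \bigcup_(a in [set` P]) X @^-1` [set a].
  apply/seteqP; split => x /=; first by exists (X x).
  by case=> a aP /= ->.
by apply: fin_bigcup_measurable => // a _; exact: mX.
Qed.

Lemma mlab_comp K J (f : K -> J) (X : T -> K) : mlab X -> mlab (f \o X).
Proof.
move=> mX b; have := mlab_set (fun a => f a == b) mX.
congr measurable; apply/seteqP; split => x /=; first by move/eqP.
by move=> <-.
Qed.

Lemma mlab_pair K J (X : T -> K) (Y : T -> J) :
  mlab X -> mlab Y -> mlab (fun x => (X x, Y x)).
Proof.
move=> mX mY [a b]; have := measurableI _ _ (mX a) (mY b).
by congr measurable; apply/seteqP; split => x /= [-> ->].
Qed.

Lemma prE K (X : T -> K) a : mlab X -> (pr X a)%:E = nu (X @^-1` [set a]).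
Proof. by move=> mX; rewrite fineK // fin_num_measure. Qed.

Lemma pr_ge0 K (X : T -> K) a : 0 <= pr X a.
Proof. by rewrite fine_ge0. Qed.

Lemma pr_set K (X : T -> K) (P : pred K) : mlab X ->
  nu [set x | P (X x)] = (\sum_(a | P a) pr X a)%:E.
Proof.
move=> mX; have -> : [set x | P (X x)] = \bigcup_(a in [set` enum P]) X @^-1` [set a].
  apply/seteqP; split => x /=.
    by move=> PX; exists (X x); rewrite //= mem_enum.
  by case=> a /=; rewrite mem_enum => aP ->.
rewrite measure_fin_bigcup //.
- rewrite -fsbig_seq ?enum_uniq // big_enum /= -sumEFin.
  by apply: eq_bigr => a _; rewrite prE.
- by move=> a b _ _ [x [<- <-]].
Qed.

Lemma pr_comp K J (f : K -> J) (X : T -> K) b : mlab X ->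
  pr (f \o X) b = \sum_(a | f a == b) pr X a.
Proof.
move=> mX; rewrite -[RHS]/(fine (_%:E)) -(pr_set (fun a => f a == b)) //.
congr (fine (nu _)); apply/seteqP; split => x /=; first by move=> <-.
by move/eqP.
Qed.

Lemma sum_pr K (X : T -> K) : mlab X -> \sum_a pr X a = 1.
Proof.
move=> mX; apply: EFin_inj; rewrite -(pr_set xpredT) //.
by rewrite -(@probability_setT _ _ _ nu); congr (nu _); apply/seteqP; split.
Qed.

Lemma pr_le1 K (X : T -> K) a : mlab X -> pr X a <= 1.
Proof.
move=> mX; rewrite -(sum_pr mX) (bigD1 a) //= lerDl.
by apply: sumr_ge0 => b _; exact: pr_ge0.
Qed.

Lemma sum_pr_comp K J (f : K -> J) (X : T -> K) (F : J -> R) : mlab X ->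
  \sum_b pr (f \o X) b * F b = \sum_a pr X a * F (f a).
Proof.
move=> mX; rewrite [RHS](partition_big f xpredT) //=; apply: eq_bigr => b _.
by rewrite pr_comp // mulr_suml; apply: eq_bigr => a /eqP ->.
Qed.

Lemma pr_comp_ge K J (f : K -> J) (X : T -> K) a : mlab X ->
  pr X a <= pr (f \o X) (f a).
Proof.
move=> mX; rewrite pr_comp // (bigD1 a) //= lerDl.
by apply: sumr_ge0 => b _; exact: pr_ge0.
Qed.

Lemma ent_ge0 K (X : T -> K) : mlab X -> 0 <= ent X.
Proof.
move=> mX; rewrite /ent -sumrN; apply: sumr_ge0 => a _.
by rewrite -mulrN mulr_ge0 ?pr_ge0 // oppr_ge0 ln_le0 ?pr_le1.
Qed.

Lemma ent_comp K J (f : K -> J) (X : T -> K) : mlab X -> ent (f \o X) <= ent X.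
Proof.
move=> mX; rewrite /ent lerN2 (sum_pr_comp _ (fun b => ln (pr (f \o X) b))) //.
apply: ler_sum => a _; have := pr_ge0 X a.
rewrite le_eqVlt => /orP[/eqP <-|pa]; first by rewrite !mul0r.
have pf := pr_comp_ge f a mX.
by rewrite ler_pM2l // ler_ln ?posrE // (lt_le_trans pa).
Qed.

Lemma ent_eq K J (X : T -> K) (Y : T -> J) (f : K -> J) (h : J -> K) :
  mlab X -> Y =1 f \o X -> X =1 h \o Y -> ent X = ent Y.
Proof.
move=> mX /funext YE /funext XE.
have mY : mlab Y by rewrite YE; exact: mlab_comp.
by apply/eqP; rewrite eq_le {1}XE ent_comp //= {1}YE ent_comp.
Qed.

Lemma ent_le_of K J (X : T -> K) (Y : T -> J) (f : K -> J) :
  mlab X -> Y =1 f \o X -> ent Y <= ent X.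
Proof. by move=> mX /funext ->; exact: ent_comp. Qed.

(** Every subprobability kernel [kap] bounds the conditional entropy of [X] given [Y], by comparison
    of the joint law with [pr Y b * kap a b]. The next two lemmas come from two choices of [kap]. *)
Lemma cond_gibbs K J (X : T -> K) (Y : T -> J) (kap : K -> J -> R) :
  mlab X -> mlab Y -> (forall a b, 0 <= kap a b) ->
  (forall b, \sum_a kap a b <= 1) ->
  (forall a b, 0 < pr (fun x => (X x, Y x)) (a, b) -> 0 < kap a b) ->
  ent (fun x => (X x, Y x)) - ent Y <=
  - \sum_c pr (fun x => (X x, Y x)) c * ln (kap c.1 c.2).
Proof.
move=> mX mY k0 k1 kpos; set XY := fun x => (X x, Y x).
have mXY : mlab XY by exact: mlab_pair.
have YE : Y = snd \o XY by [].
have pY c : pr XY c <= pr Y c.2 by rewrite YE; exact: pr_comp_ge.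
have q0 (c : K * J) : 0 <= pr Y c.2 * kap c.1 c.2 by rewrite mulr_ge0 ?pr_ge0.
have kposc c : 0 < pr XY c -> 0 < kap c.1 c.2 by case: c => a b; exact: kpos.
have := @gibbs_inequality R _ (pr XY) (fun c => pr Y c.2 * kap c.1 c.2)
  (fun c => pr_ge0 _ c) q0.
have pos c : 0 < pr XY c -> 0 < pr Y c.2 * kap c.1 c.2.
  by move=> pc; rewrite mulr_gt0 ?kposc // (lt_le_trans pc).
move=> /(_ pos).
have -> : \sum_(c : K * J) pr XY c * ln (pr Y c.2 * kap c.1 c.2) =
    \sum_c pr XY c * ln (pr Y c.2) + \sum_c pr XY c * ln (kap c.1 c.2).
  rewrite -big_split; apply: eq_bigr => c _ /=.
  have := pr_ge0 XY c; rewrite le_eqVlt => /orP[/eqP <-|pc].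
    by rewrite !mul0r addr0.
  by rewrite lnM ?posrE ?kposc ?mulrDr // (lt_le_trans pc).
rewrite opprD.
have <- : ent Y = - \sum_c pr XY c * ln (pr Y c.2).
  by rewrite /ent {1}YE (sum_pr_comp _ (fun b => ln (pr Y b))).
have H : \sum_(c : K * J) pr Y c.2 * kap c.1 c.2 <= \sum_c pr XY c.
  rewrite sum_pr // -(sum_pr mY).
  rewrite -(pair_bigA _ (fun a b => pr Y b * kap a b)) exchange_big /=.
  apply: ler_sum => b _; rewrite -mulr_sumr -[leRHS]mulr1.
  by rewrite ler_wpM2l ?pr_ge0.
move=> /(_ H) G.
by rewrite lerBlDr addrC.
Qed.

Lemma strong_subadditivity K J L (X : T -> K) (Y : T -> J) (f : J -> L) :
  mlab X -> mlab Y ->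
  ent (fun x => (X x, Y x)) - ent Y <=
  ent (fun x => (X x, f (Y x))) - ent (f \o Y).
Proof.
move=> mX mY; set Z := f \o Y.
have mZ : mlab Z by exact: mlab_comp.
set XZ := fun x => (X x, f (Y x)).
have mXZ : mlab XZ by apply: mlab_pair.
set XY := fun x => (X x, Y x).
have mXY : mlab XY by apply: mlab_pair.
have pZ c : pr XZ c <= pr Z c.2 by exact: (pr_comp_ge snd).
(* Conditional law of [X] given [f Y]; where [pr Z] vanishes the quotient is [0], so the masses
   still sum to at most [1]. *)
pose kap (a : K) (b : J) := pr XZ (a, f b) / pr Z (f b).
have XZE : XZ = (fun c => (c.1, f c.2)) \o XY by [].
apply: le_trans (cond_gibbs (kap := kap) mX mY _ _ _) _.
- by move=> a b; rewrite divr_ge0 ?pr_ge0.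
- move=> b; rewrite -mulr_suml.
  have -> : \sum_a pr XZ (a, f b) = pr Z (f b).
    have -> : Z = snd \o XZ by [].
    rewrite (pr_comp snd) // (reindex_onto (fun a => (a, f b)) fst) /=.
      by apply: eq_bigl => a; rewrite !eqxx.
    by move=> [a c] /= /eqP ->.
  have := pr_ge0 Z (f b); rewrite le_eqVlt => /orP[/eqP <-|h].
    by rewrite mul0r ler01.
  by rewrite divff // gt_eqF.
- move=> a b pab.
  have h : 0 < pr XZ (a, f b).
    by apply: (lt_le_trans pab); exact: (pr_comp_ge (fun c => (c.1, f c.2)) (a, b) mXY).
  by rewrite divr_gt0 // (lt_le_trans h) // (pZ (a, f b)).
rewrite -/XY.
have -> : \sum_c pr XY c * ln (kap c.1 c.2) =
    \sum_c pr XZ c * (ln (pr XZ c / pr Z c.2)).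
  by rewrite XZE (sum_pr_comp _ (fun c => ln (pr XZ c / pr Z c.2))).
have -> : \sum_c pr XZ c * ln (pr XZ c / pr Z c.2) =
    \sum_c pr XZ c * ln (pr XZ c) - \sum_c pr XZ c * ln (pr Z c.2).
  rewrite -sumrB; apply: eq_bigr => c _.
  have := pr_ge0 XZ c; rewrite le_eqVlt => /orP[/eqP <-|h].
    by rewrite !mul0r subr0.
  by rewrite ln_div ?mulrBr // posrE // (lt_le_trans h).
rewrite -(sum_pr_comp snd (fun b => ln (pr Z b))) //.
by rewrite /ent opprB opprK addrC.
Qed.

(* Fano's inequality in qualitative form. *)
Lemma cond_ent_small K (eta : R) : 0 < eta ->
  exists2 eps : R, 0 < eps &
  forall (J : finType) (X : T -> K) (Y : T -> J) (f : J -> K),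
    mlab X -> mlab Y -> (nu [set x | X x != f (Y x)] <= eps%:E)%E ->
    ent (fun x => (X x, Y x)) - ent Y <= eta.
Proof.
move=> eta0.
(* The test kernel will guess [f Y] with extra weight [1 - t] and spread [t] over the labels; this
   [t] makes a correct guess cost [eta / 2]. *)
pose t : R := 1 - expR (- (eta / 2)).
have e2 : 0 < eta / 2 by rewrite divr_gt0.
have t0 : 0 < t by rewrite subr_gt0 -[ltRHS]expR0 ltr_expR oppr_lt0.
have t1 : t < 1 by rewrite ltrBlDr ltrDl expR_gt0.
have [k0|k0] := posnP #|K|.
  exists 1 => // J X; have := fintype0 (X point) k0; by [].
pose k : R := #|K|%:R.
have k1 : 1 <= k by rewrite ler1n.
have kt : 1 < k / t by rewrite ltr_pdivlMr ?mul1r // (lt_le_trans t1).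
have lkt : 0 < ln (k / t) by exact: ln_gt0.
(* A wrong guess costs [ln (k / t)], so wrong guesses of mass at most [eps] cost at most the other
   [eta / 2]. *)
exists (eta / 2 / ln (k / t)); first exact: divr_gt0.
move=> J X Y f mX mY small.
apply: le_trans (strong_subadditivity f mX mY) _.
have mZ : mlab (f \o Y) by exact: mlab_comp.
pose kap (a b : K) := if a == b then 1 - t else t / k.
have tk0 : 0 < t / k by rewrite divr_gt0 // (lt_le_trans ltr01).
have mXZ : mlab (fun x => (X x, f (Y x))) by exact: (mlab_pair mX mZ).
apply: le_trans (cond_gibbs (kap := kap) mX mZ _ _ _) _.
- by move=> a b; rewrite /kap; case: ifP => _; [rewrite subr_ge0 ltW|exact: ltW].
- move=> b; rewrite (bigD1 b) //= /kap eqxx.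
  apply: (@le_trans _ _ (1 - t + \sum_(a : K) t / k)).
    rewrite lerD2l [leRHS](bigD1 b) //= -[leLHS]add0r lerD //; first exact: ltW.
    by apply: ler_sum => a /negbTE ->.
  have -> : \sum_(a : K) t / k = t.
    rewrite sumr_const -[_ *+ _]mulr_natr.
    by apply: mulfVK; rewrite gt_eqF // (lt_le_trans ltr01).
  by rewrite subrK.
- by move=> a b _; rewrite /kap; case: ifP; rewrite ?subr_gt0.
set p := pr _.
have -> : - \sum_c p c * ln (kap c.1 c.2) = \sum_c p c * - ln (kap c.1 c.2).
  by rewrite -sumrN; apply: eq_bigr => c _; rewrite mulrN.
have lnt : ln (1 - t) = - (eta / 2) by rewrite /t opprB addrC subrK expRK.
have p1 : \sum_c p c = 1 by exact: sum_pr.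
apply: (@le_trans _ _ (\sum_c (p c * (eta / 2) +
    (if c.1 != c.2 then p c else 0) * ln (k / t)))).
  apply: ler_sum => c _; rewrite /kap; case: ifP => _ /=.
    by rewrite lnt opprK mul0r addr0.
  rewrite -lnV ?posrE // invf_div lerDr.
  by rewrite mulr_ge0 ?pr_ge0 // ltW.
rewrite big_split /= -!mulr_suml p1 mul1r -big_mkcond /= [leRHS]splitr lerD2l.
rewrite -ler_pdivlMr // -lee_fin.
by rewrite -(pr_set (fun c => c.1 != c.2) mXZ).
Qed.

End FiniteEntropy.

Section WordMaps.
Variable K : finType.

Fixpoint tabulate (n : nat) (h : nat -> K) : word K n :=
  if n is m.+1 then (h 0%N, tabulate m (h \o S)) else tt.

Fixpoint wnth (k0 : K) (n : nat) : word K n -> nat -> K :=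
  if n is m.+1 then fun w i => if i is j.+1 then wnth k0 w.2 j else w.1
  else fun _ _ => k0.

Fixpoint wbelast (n : nat) : word K n.+1 -> word K n :=
  if n is m.+1 then fun w => (w.1, @wbelast m w.2) else fun _ => tt.

Fixpoint wmap (J : finType) (f : K -> J) (n : nat) : word K n -> word J n :=
  if n is m.+1 then fun w => (f w.1, wmap f w.2) else fun _ => tt.

Variables (X : Type) (T : X -> X) (P : X -> K).

Lemma itin_tabulate n x : itin T P n x = tabulate n (fun i => P (iter i T x)).
Proof.
elim: n x => [|n IH] x //=; rewrite IH; congr (_, tabulate _ _).
by apply/funext => i /=; rewrite -iterSr.
Qed.

Lemma wnth_itin k0 n x i : (i < n)%N -> wnth k0 (itin T P n x) i = P (iter i T x).
Proof. by elim: n x i => [|n IH] x [|i] //= i_n; rewrite IH // -iterSr. Qed.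

Lemma wbelast_itin n x : wbelast (itin T P n.+1 x) = itin T P n x.
Proof. elim: n x => [|n IH] x //. by move: (IH (T x)) => /= <-. Qed.

Lemma wmap_itin (J : finType) (f : K -> J) n x :
  wmap f (itin T P n x) = itin T (f \o P) n x.
Proof. by elim: n x => [|n IH] x //=; rewrite IH. Qed.

End WordMaps.

(** * Kolmogorov-Sinai entropy of an invariant measure *)

Section DynamicalEntropy.
Context {R : realType} {disp : measure_display} {T : measurableType disp}.
Variables (nu : probability T R) (S : T -> T).
Hypotheses (mS : measurable_fun setT S) (inv : invariant_measure S nu).

Lemma mlab_shift (K : finType) (X : T -> K) : mlab X -> mlab (X \o S).
Proof. by move=> mX a; have := mS measurableT (mX a); rewrite setTI. Qed.

Lemma ent_shift (K : finType) (X : T -> K) : mlab X -> ent nu (X \o S) = ent nu X.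
Proof.
move=> mX; rewrite /ent; congr (- _); apply: eq_bigr => a _.
have -> // : pr nu (X \o S) a = pr nu X a.
by rewrite /pr comp_preimage inv.
Qed.

Lemma mlab_itin (K : finType) (P : T -> K) n : mlab P -> mlab (itin S P n).
Proof.
move=> mP; elim: n => [|n IH].
  move=> a /=; rewrite (_ : _ @^-1` _ = setT); first exact: measurableT.
  by apply/seteqP; split => // x _; case: a.
exact: (mlab_pair mP (mlab_shift IH)).
Qed.

Lemma join_entropyE k (P : T -> 'I_k) n : measurable_labelling P ->
  join_entropy S nu P n = ent nu (itin S P n).
Proof.
move=> mP; pose X x : {ffun 'I_n -> 'I_k} := [ffun i : 'I_n => P (iter i S x)].
have -> : join_entropy S nu P n = ent nu X.
  rewrite /join_entropy /ent; congr (- _); apply: eq_bigr => w _.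
  have -> // : pr nu X w = fine (nu (join_cell S P w)).
  congr (fine (nu _)); apply/seteqP; split => x /=.
    by move=> <- i; rewrite ffunE.
  by move=> xw; apply/ffunP => i; rewrite ffunE xw.
pose f (w : word 'I_k n) : {ffun 'I_n -> 'I_k} :=
  [ffun i : 'I_n => wnth (P point) w i].
pose h (w : {ffun 'I_n -> 'I_k}) : word 'I_k n :=
  tabulate n (fun i => if insub i is Some j then w j else P point).
symmetry; apply: (@ent_eq _ _ _ nu _ _ _ _ f h); first exact: mlab_itin.
  by move=> x; apply/ffunP => i; rewrite !ffunE wnth_itin.
move=> x /=; rewrite itin_tabulate /h.
have E m (u v : nat -> 'I_k) : (forall i, (i < m)%N -> u i = v i) ->
    tabulate m u = tabulate m v.
  elim: m u v => [|m IH] u v uv //=; rewrite uv //; congr (_, _).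
  by apply: IH => i im; rewrite /= uv.
by apply: E => i i_n; rewrite insubT ffunE.
Qed.

Section Labelling.
Variables (K : finType) (P : T -> K).
Hypothesis mP : mlab P.

(** By invariance the increment is the conditional entropy of the present label given the next [n];
    conditioning on one more label can only lower it. *)
Lemma ent_itin_diff_le n :
  ent nu (itin S P n.+2) - ent nu (itin S P n.+1) <=
  ent nu (itin S P n.+1) - ent nu (itin S P n).
Proof.
have mn := mlab_itin (n := n) mP; have mn1 := mlab_itin (n := n.+1) mP.
have := strong_subadditivity nu (@wbelast K n) mP (mlab_shift mn1).
rewrite ent_shift //.
have -> : (@wbelast K n) \o (itin S P n.+1 \o S) = itin S P n \o S.
  by apply/funext => x; rewrite /= -[RHS]wbelast_itin.
rewrite ent_shift //.
have -> // : (fun x => (P x, wbelast ((itin S P n.+1 \o S) x))) = itin S P n.+1.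
by apply/funext => x; rewrite /comp wbelast_itin.
Qed.

Lemma ent_itin_diff_noninc m n : (m <= n)%N ->
  ent nu (itin S P n.+1) - ent nu (itin S P n) <=
  ent nu (itin S P m.+1) - ent nu (itin S P m).
Proof.
move/subnKC <-; elim: (n - m)%N => [|k IH]; rewrite ?addn0 // addnS.
exact: le_trans (ent_itin_diff_le _) IH.
Qed.

Lemma ent_itin0 : ent nu (itin S P 0) = 0.
Proof.
rewrite /ent big1 ?oppr0 // => -[] _.
have -> : pr nu (itin S P 0) tt = 1 by rewrite -(sum_pr nu (mlab_itin (n := 0) mP)) (bigD1 tt) //= big1 ?addr0 // => -[].
by rewrite ln1 mulr0.
Qed.

Lemma ent_itin_ge_diff n :
  n%:R * (ent nu (itin S P n.+1) - ent nu (itin S P n)) <= ent nu (itin S P n).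
Proof.
set D := ent nu (itin S P n.+1) - _.
have -> : n%:R * D = \sum_(k < n) D by rewrite sumr_const card_ord mulr_natl.
have -> : ent nu (itin S P n) =
    \sum_(k < n) (ent nu (itin S P k.+1) - ent nu (itin S P k)).
  rewrite -(big_mkord xpredT (fun k => ent nu (itin S P k.+1) - ent nu (itin S P k))).
  by rewrite telescope_sumr // ent_itin0 subr0.
apply: ler_sum => k _.
by apply: ent_itin_diff_noninc; exact/ltnW/ltn_ord.
Qed.

End Labelling.

(** The increments of the entropies decrease, so their averages do as well; being nonnegative, these
    converge. *)
Lemma cvg_join_entropy k (P : T -> 'I_k) : measurable_labelling P ->
  cvgn (fun n => join_entropy S nu P n / n%:R).
Proof.
move=> mP; pose u (n : nat) := join_entropy S nu P n / n%:R.
(* The term of index [0] is a division by zero, of value [0], which could break monotonicity. *)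
suff : cvgn (fun n => u n.+1).
  by move=> /cvg_ex[l]; rewrite (cvg_shiftS u) => ul; apply/cvg_ex; exists l.
rewrite /u; apply: nonincreasing_is_cvgn; last first.
  exists 0 => _ [n _ <-]; rewrite join_entropyE // divr_ge0 ?ler0n //.
  exact/ent_ge0/mlab_itin.
apply/nonincreasing_seqP => n; rewrite !join_entropyE //.
rewrite ler_pdivrMr ?ltr0n // mulrAC ler_pdivlMr ?ltr0n //.
have := ent_itin_ge_diff mP n.+1; rewrite -[in X in _ -> _ <= _ * X]natr1.
nra.
Qed.

Lemma partition_entropy_ge k (P : T -> 'I_k) h c : measurable_labelling P ->
  (forall n, n%:R * h - c <= ent nu (itin S P n)) -> h <= partition_entropy S nu P.
Proof.
move=> mP hP; have cv := cvg_join_entropy mP.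
have lim0 : (fun n : nat => h - c / n%:R) @ \oo --> h.
  rewrite -[X in _ --> X]subr0; apply: cvgB; first exact: cvg_cst.
  rewrite -(mulr0 c); apply: cvgM; first exact: cvg_cst.
  by rewrite -cvg_shiftS; exact: cvg_harmonic.
rewrite -(cvg_lim _ lim0) //; apply: ler_lim => //.
  by apply/cvg_ex; exists h.
near=> n; rewrite join_entropyE //.
have n0 : 0 < n%:R :> R by rewrite ltr0n; near: n; exact: nbhs_infty_gt.
by rewrite ler_pdivlMr // mulrBl divfK ?gt_eqF // mulrC.
Unshelve. all: by end_near. Qed.

Lemma partition_entropy_le k (P : T -> 'I_k) h c : measurable_labelling P ->
  (forall n, ent nu (itin S P n) <= n%:R * h + c) -> partition_entropy S nu P <= h.
Proof.
move=> mP hP; have cv := cvg_join_entropy mP.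
have lim0 : (fun n : nat => h + c / n%:R) @ \oo --> h.
  rewrite -[X in _ --> X]addr0; apply: cvgD; first exact: cvg_cst.
  rewrite -(mulr0 c); apply: cvgM; first exact: cvg_cst.
  by rewrite -cvg_shiftS; exact: cvg_harmonic.
rewrite -(cvg_lim _ lim0) //; apply: ler_lim => //.
  by apply/cvg_ex; exists h.
near=> n; rewrite join_entropyE //.
have n0 : 0 < n%:R :> R by rewrite ltr0n; near: n; exact: nbhs_infty_gt.
by rewrite ler_pdivrMr // mulrDl divfK ?gt_eqF // mulrC.
Unshelve. all: by end_near. Qed.

(* [P] costs nothing more than [alpha] once it is almost determined by the
   [alpha]-itinerary. *)
Lemma partition_entropy_cond_le (I : finType) (alpha : T -> I) k (P : T -> 'I_k) M :
  mlab alpha -> measurable_labelling P ->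
  partition_entropy S nu P <=
  ent nu (fun x => (P x, itin S alpha M.+1 x)) - ent nu (itin S alpha M).
Proof.
move=> ma mP.
have maM := mlab_itin (n := M) ma; have maM1 := mlab_itin (n := M.+1) ma.
(* [Q] refines [P], so its itineraries have at least as much entropy, and its increments can be
   bounded by keeping only [alpha]-labels as conditioning. *)
pose Q x := (P x, itin S alpha M x).
have mQ : mlab Q by exact: mlab_pair.
set h := (X in _ <= X).
have step n : ent nu (itin S Q n.+2) - ent nu (itin S Q n.+1) <= h.
  have mQn := mlab_itin (n := n.+1) mQ.
  (* Selects from the itinerary of [S x] the [alpha]-labels of [x] at the times [1] to [M]. *)
  pose f (w : word ('I_k * word I M)%type n.+1) : word I M := w.1.2.
  have := strong_subadditivity nu f mQ (mlab_shift mQn).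
  rewrite ent_shift // => /le_trans; apply.
  rewrite -[X in _ - ent _ X]/(itin S alpha M \o S) ent_shift // lerD2r.
  apply: (@ent_le_of _ _ _ nu _ _ (fun x => (P x, itin S alpha M.+1 x)) _
    (fun c => ((c.1, wbelast c.2), c.2.2))); first exact: (mlab_pair mP maM1).
  move=> x; rewrite /comp /=; congr (_, _, _).
  exact/esym/(wbelast_itin S alpha M x).
(* An itinerary of length [n.+1] gives only [n] increments beyond the first label; the absolute
   value of [h] makes up for the missing one. *)
apply: (@partition_entropy_le _ _ _ (ent nu (itin S Q 1) + `|h|)) => // n.
apply: (@le_trans _ _ (ent nu (itin S Q n))).
  apply: (@ent_le_of _ _ _ nu _ _ (itin S Q n) _ (@wmap _ _ fst n)).
    exact: mlab_itin.
  by move=> x; rewrite /= wmap_itin.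
case: n => [|n].
  by rewrite ent_itin0 // mul0r add0r addr_ge0 //; exact/ent_ge0/mlab_itin.
have : ent nu (itin S Q n.+1) <= n%:R * h + ent nu (itin S Q 1).
  elim: n => [|n IH]; first by rewrite mul0r add0r.
  by have := step n; rewrite -natr1 mulrDl mul1r; move: IH; lra.
by rewrite -natr1 mulrDl mul1r; have := ler_norm (- h); rewrite normrN; lra.
Qed.

End DynamicalEntropy.

(** * Cylinder sets *)

Section Cylinders.
Context {A : pointedType} {I : finType}.
Variables (d : I -> A) (e : A -> I).
Hypotheses (de : cancel d e) (ed : cancel e d).
Implicit Types (x y u v : Omega A).

Lemma near_agree x n : \forall y \near x, agree n x y.
Proof.
elim: n => [|n IH]; first by near=> y => i.
have xn : \forall y \near x, x n = y n.
  have := @proj_continuous nat (fun=> discrete_topology A) n x.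
  move=> /(_ [set x n] (discrete_set1 _)) xn.
  near=> y; apply/esym; near: y; exact: xn.
near=> y => i; rewrite ltnS leq_eqVlt => /orP[/eqP ->|i_n].
  by near: y.
suff : agree n x y by apply.
by near: y.
Unshelve. all: by end_near. Qed.

Lemma cvg_coordwise (F : set_system (Omega A)) x : Filter F ->
  (forall k, F [set y | y k = x k]) -> F --> x.
Proof.
move=> FF H.
pose Tc := (fun i : nat => Topological.class
    (initial_topology (fun f : (forall i : nat, discrete_topology A) => f i))).
apply/(@cvg_sup _ nat Tc F x) => k; apply/cvg_image.
  by apply/seteqP; split => // a _; exists (fun=> a).
move=> B /= Bx; exists [set y | B (y k)].
  by apply: filterS (H k) => y /= ->; exact: nbhs_singleton Bx.
by apply/seteqP; split => [a [y By <-]//|a Ba]; exists (fun=> a).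
Qed.

(** Otherwise points outside [U] that agree with [x] on ever longer words would converge to [x]. *)
Lemma open_agree (U : set (Omega A)) x : open U -> U x ->
  exists n, forall y, agree n x y -> U y.
Proof.
move=> oU Ux; apply: contrapT => H.
have /choice[y yP] : forall n, exists y, agree n x y /\ ~ U y.
  move=> n; apply: contrapT => Hn; apply: H; exists n => z xz.
  by apply: contrapT => Uz; apply: Hn; exists z.
have yx : y @ \oo --> x.
  apply: cvg_coordwise => k.
  suff : \forall n \near \oo, y n k = x k by [].
  by exists k.+1 => // n /= kn; rewrite -(yP n).1.
have /filter_ex[n Un] : \forall n \near \oo, U (y n).
  by apply: yx; exact: open_nbhs_nbhs.
exact: (yP n).2.
Qed.

Definition cylset (B : set (Omega A)) : Prop :=
  exists n, forall u v, agree n u v -> B u -> B v.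

Lemma agree_sym n u v : agree n u v -> agree n v u.
Proof. by move=> uv i /uv ->. Qed.

Lemma agree_leq m n u v : (m <= n)%N -> agree n u v -> agree m u v.
Proof. by move=> mn uv i im; apply: uv; exact: leq_trans mn. Qed.

Lemma cylset_open B : cylset B -> open B.
Proof.
case=> n nB; rewrite openE => x Bx; rewrite /interior /=.
by apply: filterS (near_agree x n) => y xy; exact: nB Bx.
Qed.

Lemma cylset_measurable B : cylset B -> measurable B.
Proof. by move=> /cylset_open; exact: sub_sigma_algebra. Qed.

Lemma cylsetC B : cylset B -> cylset (~` B).
Proof.
by case=> n nB; exists n => u v uv Bu Bv; apply: Bu; exact: nB (agree_sym uv) Bv.
Qed.

Lemma cylsetU B C : cylset B -> cylset C -> cylset (B `|` C).
Proof.
move=> [m mB] [n nC]; exists (maxn m n) => u v uv [Bu|Cu].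
  by left; apply: mB Bu; apply: agree_leq uv; exact: leq_maxl.
by right; apply: nC Cu; apply: agree_leq uv; exact: leq_maxr.
Qed.

Lemma cylsetI B C : cylset B -> cylset C -> cylset (B `&` C).
Proof.
by move=> cB cC; rewrite -[_ `&` _]setCK setCI; apply/cylsetC/cylsetU; exact: cylsetC.
Qed.

Lemma cylset_code n (P : pred (word I n)) : cylset [set x | P (code e n x)].
Proof. by exists n => u v uv /=; rewrite (code_agree e uv). Qed.

Lemma mlab_letter0 : mlab (letter0 e).
Proof.
move=> a; apply: cylset_measurable; exists 1%N => u v uv /= <-.
by rewrite /letter0 uv.
Qed.

Lemma mlab_code n : mlab (code e n).
Proof.
move=> w; have -> : code e n @^-1` [set w] = [set x | code e n x == w].
  by apply/seteqP; split => x /= /eqP.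
have H := cylset_code (fun v : word I n => v == w).
by apply: cylset_measurable; exact: H.
Qed.

(** An open set is the countable union over [n] of its points whose whole cylinder of length [n]
    lies in it, and each of these sets is a [cylset]. *)
Lemma measurable_cylset : @measurable _ (Omega A) = <<s cylset >>.
Proof.
apply/seteqP; split; last first.
  apply: smallest_sub; first exact: sigma_algebra_measurable.
  by move=> B; exact: cylset_measurable.
apply: smallest_sub; first exact: smallest_sigma_algebra.
move=> U oU.
pose C n := [set x | forall y, agree n x y -> U y].
have -> : U = \bigcup_n C n.
  apply/seteqP; split => [x Ux|x [n _]]; last by apply.
  by have [n nU] := open_agree oU Ux; exists n.
apply: sigma_algebra_bigcup => n; apply: sub_sigma_algebra.
exists n => u v uv Cu y vy; apply: Cu => i i_n.
by rewrite uv // vy.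
Qed.

Lemma measurable_shift : measurable_fun setT (@shift_map A).
Proof.
apply: (measurability cylset measurable_cylset).
move=> _ [B [n nB] <-]; rewrite setTI; apply: cylset_measurable.
exists n.+1 => u v uv /=; apply: nB => i i_n; exact: uv.
Qed.

Lemma measurable_fun_agree (R : realType) (f : Omega A -> R) (om : nat -> R) :
  om @ \oo --> (0 : R) -> (forall n u v, agree n u v -> f u - f v <= om n) ->
  measurable_fun setT f.
Proof.
move=> om0 f_om.
apply: (measurability _ (RGenOpens.measurableE R)).
move=> _ [_ [a [b ->] <-]]; rewrite setTI.
suff oU : open (f @^-1` `]a, b[%classic) by exact: sub_sigma_algebra.
rewrite openE => x /=; rewrite in_itv /= => /andP[ax xb].
pose eps := Num.min (f x - a) (b - f x).
have eps0 : 0 < eps by rewrite lt_min !subr_gt0 ax xb.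
have /cvgrPdist_lt/(_ _ eps0)[n _ nP] := om0.
have {}nP : om n < eps.
  by apply: le_lt_trans (nP n (leqnn n)); rewrite sub0r normrN ler_norm.
apply: filterS (near_agree x n) => y xy /=; rewrite in_itv /=.
have h1 := f_om n _ _ xy; have h2 := f_om n _ _ (agree_sym xy).
move: nP; rewrite lt_min => /andP[n1 n2].
by apply/andP; split; lra.
Qed.

Section Approximation.
Context {R : realType} (nu : probability (Omega A) R).

Definition diffset (B C : set (Omega A)) := (B `\` C) `|` (C `\` B).

Definition approximable (B : set (Omega A)) := measurable B /\
  forall eps : R, 0 < eps -> exists2 C, cylset C & (nu (diffset B C) <= eps%:E)%E.

Lemma measurable_diffset B C : measurable B -> cylset C -> measurable (diffset B C).
Proof.
by move=> mB /cylset_measurable mC; apply: measurableU; exact: measurableD.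
Qed.

Lemma approximableU B C : approximable B -> approximable C -> approximable (B `|` C).
Proof.
move=> [mB aB] [mC aC]; split; first exact: measurableU.
move=> eps eps0; have e2 : 0 < eps / 2 by rewrite divr_gt0.
have [B' cB' B'P] := aB _ e2; have [C' cC' C'P] := aC _ e2.
exists (B' `|` C'); first exact: cylsetU.
have mBB := measurable_diffset mB cB'; have mCC := measurable_diffset mC cC'.
apply: (@le_trans _ _ (nu (diffset B B' `|` diffset C C'))).
  apply: le_measure; rewrite ?inE //.
  - by apply: measurable_diffset; [exact: measurableU|exact: cylsetU].
  - exact: measurableU.
  - move=> x [[[Bx|Cx] H]|[[B'x|C'x] H]].
    + by left; left; split => // B'x; apply: H; left.
    + by right; left; split => // C'x; apply: H; right.
    + by left; right; split => // Bx; apply: H; left.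
    + by right; right; split => // Cx; apply: H; right.
apply: le_trans (measureU2 _ _ _) _ => //.
by rewrite [eps]splitr EFinD leeD.
Qed.

(** Approximable sets form a sigma-algebra containing the cylinders; a countable union is first
    truncated, by continuity of [nu] from above. *)
Lemma approximable_measurable B : measurable B -> approximable B.
Proof.
rewrite measurable_cylset; move: B; apply: smallest_sub; last first.
  move=> B cB; split; first exact: cylset_measurable.
  move=> eps eps0; exists B => //.
  by rewrite /diffset setDv setU0 measure0 lee_fin ltW.
split.
- split; first exact: measurable0.
  move=> eps eps0; exists set0; first by exists 0%N.
  by rewrite /diffset setDv setU0 measure0 lee_fin ltW.
- move=> B [mB aB]; rewrite setTD; split; first exact: measurableC.
  move=> eps /aB[C cC CP]; exists (~` C); first exact: cylsetC.
  by rewrite /diffset !setDE !setCK setUC [_ `&` C]setIC [_ `&` B]setIC -!setDE.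
- move=> B aB; have mB n : measurable (B n) by case: (aB n).
  split; first exact: bigcupT_measurable.
  move=> eps eps0; have e2 : 0 < eps / 2 by rewrite divr_gt0.
  pose D n := \big[setU/set0]_(k < n) B k.
  have aD n : approximable (D n).
    rewrite /D; elim: n => [|n IH]; last by rewrite big_ord_recr; exact: approximableU.
    rewrite big_ord0; split; first exact: measurable0.
    move=> eta eta0; exists set0; first by exists 0%N.
    by rewrite /diffset setDv setU0 measure0 lee_fin ltW.
  have mD n : measurable (D n) by case: (aD n).
  have mU : measurable (\bigcup_k B k) by exact: bigcupT_measurable.
  pose E n := (\bigcup_k B k) `\` D n.
  have mE n : measurable (E n) by exact: measurableD.
  have E0 : \bigcap_n E n = set0.
    apply/seteqP; split => // x Ex; have [[k _ Bx] _] := Ex 0%N Logic.I.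
    by have [_] := Ex k.+1 Logic.I; apply; rewrite /D big_ord_recr; right.
  have cE : nu \o E @ \oo --> (0 : \bar R)%E.
    rewrite -(measure0 nu) -E0; apply: nonincreasing_cvg_mu => //.
    - by rewrite (le_lt_trans (probability_le1 _ _)) // ltry.
    - by rewrite E0; exact: measurable0.
    - move=> m n mn; apply/subsetPset => x [Ux nD]; split => // Dx; apply: nD.
      by move: Dx; exact: subset_bigsetU.
  have [n Pn] : exists n, (nu (E n) <= (eps / 2)%:E)%E.
    move/fine_cvgP : cE => [_ /cvgrPdist_le/(_ _ e2)[n _ nP]].
    exists n; have := nP n (leqnn n); rewrite /= sub0r normrN => H.
    rewrite -[nu (E n)]fineK ?fin_num_measure // lee_fin.
    exact: le_trans (ler_norm _) H.
  have [C cC CP] := (aD n).2 _ e2.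
  exists C => //; have mDC := measurable_diffset (mD n) cC.
  apply: (@le_trans _ _ (nu (E n `|` diffset (D n) C))).
    apply: le_measure; rewrite ?inE //.
    - exact: measurable_diffset.
    - exact: measurableU.
    - move=> x [[Ux nC]|[Cx nU]].
      + have [Dx|nD] := pselect (D n x); first by right; left.
        by left.
      + right; right; split => // Dx; apply: nU; move: Dx; rewrite /D -bigcup_mkord.
        by case=> k _ Bx; exists k.
  apply: le_trans (measureU2 _ _ _) _ => //.
  by rewrite [eps]splitr EFinD leeD.
Qed.

Lemma approximable_labelling k (P : Omega A -> 'I_k) (eps : R) :
  measurable_labelling P -> 0 < eps ->
  exists n, forall m, (n <= m)%N -> exists f : word I m -> 'I_k,
    (nu [set x | P x != f (code e m x)] <= eps%:E)%E.
Proof.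
move=> mP eps0.
have k0 : (0 < k)%N by case: k P mP => // P; case: (P point).
have ek0 : 0 < eps / k%:R by rewrite divr_gt0 // ltr0n.
have /choice[C /all_and2[cC CP]] : forall c, exists C, cylset C /\
    (nu (diffset (P @^-1` [set c]) C) <= (eps / k%:R)%:E)%E.
  move=> c; have [C cC CP] := (approximable_measurable (mP c)).2 _ ek0.
  by exists C.
have /choice[N NP] : forall c, exists n, forall u v, agree n u v -> C c u -> C c v.
  by move=> c; exact: cC.
exists (\max_c N c)%N => m Nm.
(* Outside the union of the symmetric differences a point lies in [C c] for its own label [c] only,
   so [pick] finds it; the default is reached only on the bad set. *)
pose f (w : word I m) : 'I_k :=
  if [pick c | `[< C c (glue d w point) >]] is Some c then c else P point.
exists f.
pose D c := diffset (P @^-1` [set c]) (C c).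
have mD c : measurable (D c) by exact: measurable_diffset.
have sub : [set x | P x != f (code e m x)] `<=` \big[setU/set0]_c D c.
  move=> x /= /eqP Px; apply: contrapT => nD.
  have CE c : C c (glue d (code e m x) point) <-> P x = c.
    have gx := agree_glue_code (n := m) ed x point.
    have NcM : (N c <= m)%N by apply: leq_trans Nm; exact: leq_bigmax.
    have CC : C c (glue d (code e m x) point) <-> C c x.
      by split; apply: NP; [apply/agree_sym|]; exact: agree_leq gx.
    rewrite CC; split => [Cx|Pc]; apply: contrapT => H;
      apply: nD; rewrite (bigD1 c) //=; left; [right|left]; by [].
  apply: Px; rewrite /f; case: pickP => [c /asboolP/CE //|/(_ (P x))].
  by move=> /asboolP; case; apply/CE.
apply: (@le_trans _ _ (nu (\big[setU/set0]_c D c))).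
  apply: le_measure; rewrite ?inE //; last by apply: bigsetU_measurable.
  have := mlab_set (fun c => c.1 != f c.2) (mlab_pair mP (mlab_code (n := m))).
  by [].
apply: (@le_trans _ _ (\sum_c nu (D c))%E).
  elim: (index_enum 'I_k) => [|c s IH]; first by rewrite !big_nil measure0.
  rewrite !big_cons; apply: le_trans (measureU2 _ _ _) _ => //.
    exact: bigsetU_measurable.
  by rewrite leeD2l.
apply: (@le_trans _ _ (\sum_(c < k) (eps / k%:R)%:E)%E).
  by apply: lee_sum => c _; exact: CP.
by rewrite sumEFin sumr_const card_ord -[_ *+ _]mulr_natr divfK // pnatr_eq0 -lt0n.
Qed.

End Approximation.

End Cylinders.

Section CylinderMeasures.
Context {R : realType} {A : pointedType} {I : finType}.
Variables (d : I -> A) (e : A -> I).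
Hypotheses (de : cancel d e) (ed : cancel e d).
Implicit Types (x y u v : Omega A).

Section InvariantEntropy.
Variable nu : probability (Omega A) R.
Hypothesis inv : invariant_measure (@shift_map A) nu.

(** The letters generate: [P] is nearly determined by a word of length [m.+1], so by Fano's
    inequality its entropy exceeds the increment at depth [m] by at most [eta], and the increments
    decrease with depth. *)
Lemma entropy_le M :
  (entropy (@shift_map A) nu <= (ent nu (code e M.+1) - ent nu (code e M))%:E)%E.
Proof.
apply: ge_ereal_sup => _ [k [P [mP ->]]]; rewrite lee_fin.
apply/ler_addgt0Pr => eta eta0.
have [eps eps0 small] := cond_ent_small nu 'I_k eta0.
have [n nP] := approximable_labelling ed nu mP eps0.
pose m := maxn n M; have [f fP] := nP m.+1 (leqW (leq_maxl _ _)).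
have mS := @measurable_shift A.
have ma := mlab_letter0 e.
apply: le_trans (partition_entropy_cond_le mS inv m ma mP) _.
have := small _ _ _ f mP (@mlab_code _ _ e m.+1) fP.
have := ent_itin_diff_noninc mS inv ma (leq_maxr n M).
rewrite -/m /code; lra.
Qed.

End InvariantEntropy.

Lemma invariant_of_cylinders (nu : probability (Omega A) R) :
  (forall n (w : word I n),
    nu [set x | code e n (shift_map x) = w] = nu [set x | code e n x = w]) ->
  invariant_measure (@shift_map A) nu.
Proof.
move=> H; have mS := @measurable_shift A.
pose T : (Omega A) -> (Omega A) := @shift_map A.
move=> B mB.
have cyl C : cylset C -> nu (T @^-1` C) = nu C.
  case=> n nC.
  pose P (w : word I n) := `[< C (glue d w point) >].
  have CE x : C x <-> P (code e n x).
    have gx := agree_glue_code (n := n) ed x point.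
    by split => [Cx|/asboolP]; [apply/asboolP; exact: nC Cx | apply: nC; exact: agree_sym].
  have -> : C = [set x | P (code e n x)] by apply/seteqP; split => x /CE.
  have mc := @mlab_code _ _ e n.
  rewrite (pr_set nu P mc).
  rewrite -[T @^-1` _]/[set x | P ((code e n \o T) x)] (pr_set nu P (mlab_shift mS mc)).
  by congr (_%:E); apply: eq_bigr => w _; rewrite /pr H.
pose X : {mfun Omega A >-> Omega A} := mfun_Sub (mem_set mS).
have := @measure_unique _ R (Omega A) cylset (fun=> setT)
  (@measurable_cylset A) (@cylsetI A) _ _ (distribution nu X) nu _ _ B mB.
apply; first by exists 0%N.
- by rewrite bigcup_const //; exists 0%N.
- by move=> C; exact: cyl.
- move=> i; apply: (@le_lt_trans _ _ 1%E); [exact: probability_le1 | exact: ltry].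
Qed.

End CylinderMeasures.

(** * Measures with prescribed cylinder masses *)

Section DigitExpansion.
Context {R : realType}.

Section Choice.
Variables (k : nat) (p : 'I_k -> R).
Hypothesis p_ge0 : forall a, 0 <= p a.

Definition cumul (n : nat) : R := \sum_(b < k | (b < n)%N) p b.

Lemma cumulS (a : 'I_k) : cumul a.+1 = cumul a + p a.
Proof.
rewrite /cumul (bigD1 a) //= addrC; congr (_ + _); apply: eq_bigl => b.
by rewrite ltnS ltn_neqAle andbC.
Qed.

Lemma cumul_le m n : (m <= n)%N -> cumul m <= cumul n.
Proof.
move=> mn; rewrite /cumul big_mkcond [leRHS]big_mkcond; apply: ler_sum => b _.
case: ifP => bm; last by case: ifP.
by rewrite (leq_trans bm mn).
Qed.

Lemma cumul0 : cumul 0 = 0.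
Proof. by rewrite /cumul big_pred0. Qed.

Lemma cumul_full : cumul k = \sum_b p b.
Proof. by rewrite /cumul; apply: eq_bigl => b; rewrite ltn_ord. Qed.

(** The half-open slots tile the interval from [0] to the total mass; a letter of mass zero gets an
    empty slot. *)
Definition in_slot (t : R) (a : 'I_k) := cumul a <= t < cumul a + p a.

Lemma slot_exists t : 0 <= t < \sum_b p b -> exists a, in_slot t a.
Proof.
case/andP => t0 t1.
have ex0 : exists n, cumul n <= t by exists 0%N; rewrite cumul0.
have ub n : cumul n <= t -> (n <= k)%N.
  move=> nt; rewrite leqNgt; apply/negP => /ltnW/cumul_le kn.
  by have := le_lt_trans (le_trans kn nt) t1; rewrite -cumul_full ltxx.
case: (ex_maxnP ex0 ub) => n nt nmax.
have nk : (n < k)%N.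
  rewrite ltn_neqAle ub // andbT; apply/negP => /eqP nE.
  by move: nt; rewrite nE cumul_full leNgt t1.
exists (Ordinal nk); rewrite /in_slot nt -cumulS ltNge; apply/negP => /nmax.
by rewrite ltnn.
Qed.

Lemma slot_unique t a b : in_slot t a -> in_slot t b -> a = b.
Proof.
move=> /andP[a1 a2] /andP[b1 b2]; apply/val_inj => /=.
rewrite -!cumulS in a2 b2.
case: (ltngtP a b) => // ab.
  by have := le_lt_trans (le_trans (cumul_le ab) b1) a2; rewrite ltxx.
by have := le_lt_trans (le_trans (cumul_le ab) a1) b2; rewrite ltxx.
Qed.

Lemma in_slot_range t a : in_slot t a -> 0 <= t < \sum_b p b.
Proof.
move=> /andP[a1 a2]; rewrite -cumul_full -cumul0; apply/andP; split.
  by apply: le_trans a1; exact: cumul_le.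
by apply: (lt_le_trans a2); rewrite -cumulS; exact: cumul_le.
Qed.

End Choice.

Context {A : pointedType} {k : nat}.
Variables (d : 'I_k -> A) (e : A -> 'I_k).
Hypotheses (de : cancel d e) (ed : cancel e d).
Implicit Types (m : set (Omega A) -> R) (x : Omega A).

Definition finadd m := (forall B, 0 <= m B) /\
  (forall B C, B `&` C = set0 -> m (B `|` C) = m B + m C).

(** Unnormalised conditional mass after a first letter [a]; no division by a possibly zero mass
    occurs. *)
Definition child m (a : 'I_k) : set (Omega A) -> R :=
  fun B => m [set x | letter0 e x = a /\ B (shift_map x)].

Lemma finadd_child m a : finadd m -> finadd (child m a).
Proof.
move=> [m0 mU]; split => [B|B C BC]; first exact: m0.
rewrite /child -mU; last first.
  apply/seteqP; split => // x [[_ Bx] [_ Cx]].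
  by have : (B `&` C) (shift_map x) by []; rewrite BC.
congr m; apply/seteqP; split => x /=; first by case=> ? [?|?]; [left|right].
by case=> -[? ?]; split => //; [left|right].
Qed.

Lemma finadd0 m : finadd m -> m set0 = 0.
Proof.
move=> [_ mU]; have := mU set0 set0 (setI0 _); rewrite setU0 => /esym.
by rewrite -[RHS]add0r => /addIr.
Qed.

Lemma finadd_set m (K : finType) (X : Omega A -> K) (P : pred K) : finadd m ->
  m [set x | P (X x)] = \sum_(a | P a) m [set x | X x = a].
Proof.
move=> fm; have [_ mU] := fm; rewrite -big_enum /=.
have -> : [set x | P (X x)] = [set x | X x \in enum P].
  by apply/seteqP; split => x /=; rewrite mem_enum.
elim: (enum P) (enum_uniq P) => [_|a s IH /andP[ans us]].
  by rewrite big_nil -(finadd0 fm); congr m; apply/seteqP; split=> x.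
rewrite big_cons -IH // -mU; last first.
  apply/seteqP; split => // x [/= ax xs].
  by move: ans; rewrite -ax xs.
congr m; apply/seteqP; split => x /=.
  by rewrite inE => /orP[/eqP ->|->]; [left|right].
by case=> [->|xs]; rewrite inE ?eqxx // xs orbT.
Qed.

Lemma sum_child m : finadd m -> \sum_a child m a setT = m setT.
Proof.
move=> fm.
have -> : m setT = \sum_(a | xpredT a) m [set x | letter0 e x = a].
  by rewrite -(finadd_set (letter0 e) xpredT fm); congr m; apply/seteqP; split.
by apply: eq_bigr => a _; congr m; apply/seteqP; split => x //= -[].
Qed.

Definition digit (s : (set (Omega A) -> R) * R) : 'I_k :=
  odflt (e point) [pick a | in_slot (fun a => child s.1 a setT) s.2 a].

(** The state holds the mass still to be subdivided and the position inside the current slot, never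
    rescaled. *)
Definition digit_step (s : (set (Omega A) -> R) * R) :=
  (child s.1 (digit s), s.2 - cumul (fun a => child s.1 a setT) (digit s)).

Definition expand (s : (set (Omega A) -> R) * R) : Omega A :=
  fun n => d (digit (iter n digit_step s)).

Lemma shift_expand s : shift_map (expand s) = expand (digit_step s).
Proof. by apply/funext => n; rewrite /shift_map /expand iterSr. Qed.

Lemma digitP m t a : finadd m ->
  0 <= t < m setT /\ digit (m, t) = a <-> in_slot (fun a => child m a setT) t a.
Proof.
move=> fm; have p0 b : 0 <= child m b setT by exact: (finadd_child b fm).1.
rewrite -(sum_child fm); split => [[tr <-]|ta].
  rewrite /digit; case: pickP => //= H.
  by have [b] := slot_exists p0 tr; rewrite H.
split; first exact: in_slot_range ta.
rewrite /digit; case: pickP => [b /= tb|/(_ a)]; last by rewrite /= ta.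
exact: slot_unique tb ta.
Qed.

(** Induction on the word: the expansions beginning with [a] fill the slot of [a], where the rest of
    the word cuts out an interval translated by [q a]. *)
Lemma expand_cylinder n (w : word 'I_k n) m : finadd m ->
  exists c, forall t, (0 <= t < m setT /\ code e n (expand (m, t)) = w) <->
    c <= t < c + m [set x | code e n x = w].
Proof.
elim: n w m => [w m fm|n IH [a w] m fm].
  exists 0 => t; rewrite add0r.
  have -> : [set x | code e 0 x = w] = setT.
    by apply/seteqP; split => // x _; case: w.
  by split => [[]//|]; split => //; case: w.
have [c' c'P] := IH w _ (finadd_child a fm).
pose q := cumul (fun a => child m a setT).
exists (q a + c') => t.
have -> : [set x | code e n.+1 x = (a, w)] =
    [set x | letter0 e x = a /\ code e n (shift_map x) = w].
  by apply/seteqP; split => x /= [<- <-].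
rewrite -/(child m a [set x | code e n x = w]).
have codeE : code e n.+1 (expand (m, t)) =
    (digit (m, t), code e n (expand (digit_step (m, t)))).
  by rewrite -shift_expand /code /= /letter0 /expand /= de.
have -> : (q a + c' <= t < q a + c' + child m a [set x | code e n x = w]) =
    (c' <= t - q a < c' + child m a [set x | code e n x = w]).
  by rewrite lerBrDl ltrBlDl addrA.
split => [[tr]|].
  rewrite codeE => -[da wE].
  have ts := (digitP t a fm).1 (conj tr da).
  apply/c'P; split; first by rewrite subr_ge0 ltrBlDl.
  by move: wE; rewrite /digit_step /= da.
move=> /c'P[]; rewrite subr_ge0 ltrBlDl => ts wE.
have [tr da] := (digitP t a fm).2 ts.
by split => //; rewrite codeE /digit_step /= da wE.
Qed.

End DigitExpansion.

Section CylinderExtension.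
Context {R : realType}.

Definition unit_lebesgue : set (measurableTypeR R) -> \bar R :=
  mrestr (@lebesgue_measure R) (measurable_itv `[0, 1[).

HB.instance Definition _ := Measure.copy unit_lebesgue
  (mrestr (@lebesgue_measure R) (measurable_itv `[0, 1[)).

Let unit_lebesgue_setT : unit_lebesgue setT = 1%E.
Proof.
by rewrite /unit_lebesgue /mrestr setTI lebesgue_measure_itv /= lte_fin ltr01 sube0.
Qed.

HB.instance Definition _ :=
  Measure_isProbability.Build _ _ _ unit_lebesgue unit_lebesgue_setT.

Context {A : pointedType} {k : nat}.
Variables (d : 'I_k -> A) (e : A -> 'I_k).
Hypotheses (de : cancel d e) (ed : cancel e d).

(* The measure is the image of Lebesgue measure under the digit expansion
   driven by [m], so that no compactness argument is needed. *)
Lemma finadd_extension (m : set (Omega A) -> R) : finadd m -> m setT = 1 ->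
  exists nu : probability (Omega A) R, forall n (w : word 'I_k n),
    nu [set x | code e n x = w] = (m [set x | code e n x = w])%:E.
Proof.
move=> fm m1.
pose X (t : measurableTypeR R) : Omega A := if 0 <= t < 1 then expand d e (m, t) else point.
have slot n (w : word 'I_k n) : exists c, forall t,
    0 <= t < 1 -> (code e n (X t) = w <-> c <= t < c + m [set x | code e n x = w]).
  have [c cP] := expand_cylinder de w fm; exists c => t t01.
  rewrite /X t01; move: (cP t); rewrite m1 t01 => <-.
  by split => [|[]].
have unit_set n (w : word 'I_k n) : exists2 c, 
    X @^-1` [set x | code e n x = w] `&` `[0, 1[%classic =
    `[c, c + m [set x | code e n x = w][%classic & True.
  have [c cP] := expand_cylinder de w fm; exists c => //.
  apply/seteqP; split => t /=; rewrite !in_itv /=.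
    by move=> [Xw t01]; apply/cP; rewrite m1; move: Xw; rewrite /X t01.
  by move=> /cP; rewrite m1 => -[t01 ?]; rewrite /X t01.
have mX : measurable_fun setT X.
  apply: (measurability cylset (@measurable_cylset A)).
  move=> _ [B [n nB] <-]; rewrite setTI.
  (* Inside the unit interval the preimage is a finite union of intervals, one for each word;
     outside, [X] is constant. *)
  have -> : X @^-1` B =
      (\bigcup_(w in [set w : word 'I_k n | B (glue d w point)])
        (X @^-1` [set x | code e n x = w] `&` `[0, 1[%classic)) `|`
      (~` `[0, 1[%classic `&` [set _ | B point]).
    have BE x : B x <-> B (glue d (code e n x) point).
      by have gx := agree_glue_code (n := n) ed x point;
        split; apply: nB; [|exact: agree_sym].
    apply/seteqP; split => t /=.
      move=> Bt; have [t01|t01] := boolP (0 <= t < 1).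
        left; exists (code e n (X t)); first exact: (BE _).1 Bt.
        by split => //; rewrite /= in_itv.
      right; split; first by rewrite in_itv /=; apply/negP.
      by move: Bt; rewrite /X (negbTE t01).
    case=> [[w wB [/= wE _]]|[]]; first by apply: (BE _).2; rewrite wE.
    by rewrite in_itv /= /X => /negP/negbTE ->.
  apply: measurableU.
    apply: fin_bigcup_measurable => // w _.
    by have [c -> _] := unit_set n w; exact: measurable_itv.
  apply: measurableI; first by apply: measurableC; exact: measurable_itv.
  have [Bp|Bp] := pselect (B point).
    by have -> : [set _ : measurableTypeR R | B point] = setT by apply/seteqP; split => t.
  have -> : [set _ : measurableTypeR R | B point] = set0 by apply/seteqP; split => t.
  exact: measurable0.
pose P : probability (measurableTypeR R) R := unit_lebesgue.
pose XX : {mfun measurableTypeR R >-> Omega A} := mfun_Sub (mem_set mX).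
exists (distribution P XX) => n w.
rewrite /distribution /pushforward /= /unit_lebesgue /mrestr.
have [c -> _] := unit_set n w.
have m0 := fm.1 [set x | code e n x = w].
rewrite lebesgue_measure_itv /= lte_fin ltrDl.
case: ltP => [_|]; first by rewrite -EFinD addrC addKr.
by move=> mle; congr (_%:E); apply/le_anti; rewrite m0 mle.
Qed.

End CylinderExtension.

(** * An invariant measure with the upper Gibbs bound *)

Lemma fmap_ultra (S T : Type) (f : S -> T) (F : set_system S) :
  UltraFilter F -> UltraFilter (f @ F).
Proof.
move=> FU; have FP : ProperFilter F by exact: ultra_proper.
constructor; first exact: fmap_proper_filter.
move=> G GP sFG; apply/seteqP; split => [B GB|]; last exact: sFG.
have [//|FnB] := in_ultra_setVsetC (f @^-1` B) FU.
have GnB : G (~` B) by apply: sFG.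
by have /filter_ex[x []] : G (B `&` ~` B) by exact: filterI.
Qed.

Section InvariantGibbs.
Context {R : realType} {A : pointedType} {k : nat}.
Variables (d : 'I_k -> A) (e : A -> 'I_k).
Hypotheses (de : cancel d e) (ed : cancel e d).
Variables (phi : Omega A -> R) (rem : nat -> R).
Hypothesis phi_rem : forall n u v, agree n u v -> phi u - phi v <= rem n - rem n.+1.
Hypothesis rem_ge0 : forall n, 0 <= rem n.
Variable y0 : Omega A.
Implicit Types (B C : set (Omega A)).

Let T := @shift_map A.
Let ind B (x : Omega A) : R := `[< B x >]%:R.
Let Z n := pfun d phi n y0.

(* Probability of [B], seen from position [s], under the finite-volume Gibbs
   measure on [2 (n + 1)] letters with boundary condition [y0]. *)
Definition gibbs_at n s B : R :=
  iter (n.+1 + n.+1) (transfer d phi) (fun x => ind B (iter s T x)) y0 /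
  Z (n.+1 + n.+1).

(** Krylov-Bogolyubov average over the first half of the box: a word of length [j <= n] seen from a
    position [s <= n] stays inside, where the upper Gibbs bound is uniform in [s]. *)
Definition gibbs_mean n B : R := n.+1%:R^-1 * \sum_(s < n.+1) gibbs_at n s B.

Let Z_gt0 n : 0 < Z n. Proof. exact: (pfun_gt0 d e). Qed.

Let iter_transfer_ge0 i f : (forall x, 0 <= f x) -> 0 <= iter i (transfer d phi) f y0.
Proof.
move=> f0; rewrite -(mul0r (iter i (transfer d phi) (fun=> 1) y0)) -iter_transferZ.
by apply: iter_transfer_le => x; rewrite mul0r.
Qed.

Lemma gibbs_at_ge0 n s B : 0 <= gibbs_at n s B.
Proof.
rewrite divr_ge0 //; last exact/ltW/Z_gt0.
by apply: iter_transfer_ge0 => x; rewrite /ind.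
Qed.

Lemma gibbs_atU n s B C : B `&` C = set0 ->
  gibbs_at n s (B `|` C) = gibbs_at n s B + gibbs_at n s C.
Proof.
move=> BC; rewrite /gibbs_at -mulrDl -iter_transferD; congr (_ / _).
apply: iter_transfer_ext => x; rewrite /ind.
set z := iter s T x; have BCz : ~ (B z /\ C z).
  by move=> H; have : (B `&` C) z by []; rewrite BC.
have [Bz|nB] := asboolP (B z); have [Cz|nC] := asboolP (C z).
- by case: BCz.
- by rewrite asboolT ?addr0 //; left.
- by rewrite asboolT ?add0r //; right.
- by rewrite asboolF ?addr0 // => -[].
Qed.

Lemma gibbs_atT n s : gibbs_at n s setT = 1.
Proof.
rewrite /gibbs_at.
have -> : (fun x => ind setT (iter s T x)) = fun=> 1.
  by apply/funext => x; rewrite /ind asboolT.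
by rewrite divff // gt_eqF //; exact: (Z_gt0 (n.+1 + n.+1)).
Qed.

Lemma gibbs_at_le1 n s B : gibbs_at n s B <= 1.
Proof.
rewrite -(gibbs_atT n s) -(setUv B) gibbs_atU ?setICr // lerDl.
exact: gibbs_at_ge0.
Qed.

Lemma gibbs_at_shift n s B : gibbs_at n s (T @^-1` B) = gibbs_at n s.+1 B.
Proof. by []. Qed.

Lemma gibbs_mean_ge0 n B : 0 <= gibbs_mean n B.
Proof.
by rewrite mulr_ge0 ?invr_ge0 ?ler0n //; apply: sumr_ge0 => s _; exact: gibbs_at_ge0.
Qed.

Lemma gibbs_meanU n B C : B `&` C = set0 ->
  gibbs_mean n (B `|` C) = gibbs_mean n B + gibbs_mean n C.
Proof.
move=> BC; rewrite /gibbs_mean -mulrDr -big_split /=; congr (_ * _).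
by apply: eq_bigr => s _; exact: gibbs_atU.
Qed.

Lemma gibbs_meanT n : gibbs_mean n setT = 1.
Proof.
rewrite /gibbs_mean (eq_bigr (fun=> 1)); last by move=> s _; exact: gibbs_atT.
by rewrite sumr_const card_ord mulVf // pnatr_eq0.
Qed.

Lemma gibbs_mean_le1 n B : gibbs_mean n B <= 1.
Proof.
rewrite -(gibbs_meanT n) -(setUv B) gibbs_meanU ?setICr // lerDl.
exact: gibbs_mean_ge0.
Qed.

Lemma gibbs_mean_shift n B :
  `|gibbs_mean n (T @^-1` B) - gibbs_mean n B| <= n.+1%:R^-1.
Proof.
rewrite /gibbs_mean -mulrBr -sumrB.
rewrite -(big_mkord xpredT (fun s => gibbs_at n s (T @^-1` B) - gibbs_at n s B)).
under eq_bigr do rewrite gibbs_at_shift.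
rewrite telescope_sumr // normrM ger0_norm ?invr_ge0 ?ler0n //.
rewrite ler_piMr ?invr_ge0 ?ler0n // ler_norml.
have := gibbs_at_ge0 n n.+1 B; have := gibbs_at_le1 n n.+1 B.
have := gibbs_at_ge0 n 0 B; have := gibbs_at_le1 n 0 B.
by move=> *; apply/andP; split; lra.
Qed.

Lemma gibbs_mean_cylinder n j (w : word 'I_k j) : (j <= n)%N ->
  gibbs_mean n [set x | code e j x = w] <=
  expR (4 * rem 1%N) * (expR (wsum d phi w y0) / Z j).
Proof.
move=> jn; set c := (X in _ <= X).
rewrite /gibbs_mean ler_pdivrMl ?ltr0n // mulr_natl -[in leRHS](card_ord n.+1).
rewrite -sumr_const; apply: ler_sum => s _.
rewrite /gibbs_at ler_pdivrMr //.
have -> : (n.+1 + n.+1 = (n.+1 + n.+1 - (j + s)) + (j + s))%N.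
  by rewrite subnK // leq_add // ltnW.
apply: le_trans (iter_transfer_cylinder_le de phi_rem rem_ge0 _ _ w y0).
apply: iter_transfer_le => x; rewrite /ind.
by have [->|_] := asboolP; rewrite ?eqxx ?ler0n.
Qed.

Lemma invariant_gibbs_exists : exists nu : probability (Omega A) R,
  invariant_measure T nu /\ forall j (w : word 'I_k j),
    pr nu (code e j) w <= expR (4 * rem 1%N) * (expR (wsum d phi w y0) / Z j).
Proof.
have [U [UU ooU]] := @ultraFilterLemma nat \oo _.
have UP : ProperFilter U by exact: ultra_proper.
(* The image of an ultrafilter in the compact unit interval converges, so all sets [B] get a limit
   along the same [U]. *)
have /choice[m mP] : forall B, exists l : R, (fun n => gibbs_mean n B) @ U --> l.
  move=> B; have FU := fmap_ultra (fun n => gibbs_mean n B) UU.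
  have := @segment_compact R 0 1; rewrite compact_ultra => /(_ _ FU)[].
    apply: (@filterS _ U _ setT); last exact: filterT.
    by move=> n _; rewrite /= in_itv /= gibbs_mean_ge0 gibbs_mean_le1.
  by move=> l [_ Ul]; exists l.
have lim_eq (f g : nat -> R) (a b : R) : f @ U --> a -> g @ U --> b ->
    (forall n, f n = g n) -> a = b.
  move=> fa gb /funext fg; rewrite fg in fa.
  exact: (cvg_unique (@norm_hausdorff _ R) fa gb).
have lim_le (f : nat -> R) (a b : R) : f @ U --> a ->
    (\forall n \near \oo, f n <= b) -> a <= b.
  move=> fa fb; have fb' : \forall n \near U, f n <= b by exact: ooU.
  have cf : cvg (f @ U) by apply/cvg_ex; exists a.
  by rewrite -(cvg_lim (@norm_hausdorff _ R) fa); exact: limr_le.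
have lim_ge (f : nat -> R) (a b : R) : f @ U --> a ->
    (\forall n \near \oo, b <= f n) -> b <= a.
  move=> fa fb; have fb' : \forall n \near U, b <= f n by exact: ooU.
  have cf : cvg (f @ U) by apply/cvg_ex; exists a.
  by rewrite -(cvg_lim (@norm_hausdorff _ R) fa); exact: limr_ge.
have fm : finadd m.
  split => [B|B C BC].
    by apply: lim_ge (mP B) _; apply: nearW => n; exact: gibbs_mean_ge0.
  apply: (lim_eq _ _ _ _ (mP (B `|` C)) (cvgD (mP B) (mP C))) => n.
  exact: gibbs_meanU.
have m1 : m setT = 1.
  by apply: (lim_eq _ _ _ _ (mP setT) (@cvg_cst _ _ _ _ _)) => n; exact: gibbs_meanT.
have mT B : m (T @^-1` B) = m B.
  apply/eqP; rewrite -subr_eq0 -normr_le0; apply/ler_addgt0Pr => eps eps0.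
  rewrite add0r.
  apply: (lim_le _ _ _ (cvg_norm (cvgB (mP (T @^-1` B)) (mP B)))).
  have /cvgrPdist_le/(_ _ eps0) := @cvg_harmonic R.
  apply: filterS => n; rewrite /harmonic /= sub0r normrN => h.
  apply: le_trans (gibbs_mean_shift n B) _.
  exact: le_trans (ler_norm _) h.
have [nu nuP] := finadd_extension de ed fm m1.
exists nu; split.
  apply: (invariant_of_cylinders ed) => n w.
  (* The preimage of a cylinder is a union of cylinders one letter longer, on which [nu] and [m]
     already agree. *)
  pose P (v : word 'I_k n.+1) := v.2 == w.
  have PE : [set x | code e n (shift_map x) = w] = [set x | P (code e n.+1 x)].
    by apply/seteqP; split => x /= /eqP.
  rewrite nuP -(mT [set x | code e n x = w]) [T @^-1` _]PE PE (finadd_set _ _ fm).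
  rewrite (pr_set nu P (@mlab_code _ _ e n.+1)); congr (_%:E).
  by apply: eq_bigr => v _; apply: EFin_inj; rewrite prE ?nuP //; exact: mlab_code.
move=> j w; rewrite -lee_fin prE; last exact: mlab_code.
rewrite [X in (X <= _)%E]nuP lee_fin.
apply: lim_le (mP _) _; exists j => // n /= jn; exact: gibbs_mean_cylinder.
Qed.

End InvariantGibbs.

(** * Pressure and relative entropy *)

Section WordMeans.
Context {R : realType} {A : pointedType} {I : finType}.
Variables (d : I -> A) (e : A -> I).
Hypotheses (de : cancel d e) (ed : cancel e d).
Variables (nu : probability (Omega A) R) (y0 : Omega A).
Implicit Types (f g : Omega A -> R).

(** Finite-sum surrogate of the integral: the letters after the first [n] are frozen to those of
    [y0]. *)
Definition wmean n f : R := \sum_w pr nu (code e n) w * f (glue d w y0).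

Lemma integral_code n (g : word I n -> R) :
  nu.-integrable setT (EFin \o (g \o code e n)) /\
  (\int[nu]_x (g (code e n x))%:E = (\sum_w pr nu (code e n) w * g w)%:E)%E.
Proof.
pose cyl w := code e n @^-1` [set w].
have mc w : measurable (cyl w) by exact: mlab_code.
have int1 w : nu.-integrable setT (fun x => (g w)%:E * (\1_(cyl w) x)%:E)%E.
  apply: integrableZl => //; exact: integrable_indic.
have gE x : ((g (code e n x))%:E = \sum_w (g w)%:E * (\1_(cyl w) x)%:E)%E.
  rewrite (bigD1 (code e n x)) //= big1 ?adde0 => [|w wx].
    by rewrite indicE mem_set // mule1.
  by rewrite indicE memNset ?mule0 // => xw; move: wx; rewrite -xw eqxx.
split.
  rewrite (_ : EFin \o _ = fun x => (\sum_w (g w)%:E * (\1_(cyl w) x)%:E)%E).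
    by apply: integrable_sum => // w _; exact: int1.
  by apply/funext => x; rewrite /= gE.
under eq_integral do rewrite gE.
rewrite integral_sum // -sumEFin; apply: eq_bigr => w _.
rewrite integralZl //; last first.
  exact: integrable_indic.
rewrite integral_indic // setIT muleC EFinM; congr (_ * _)%E.
by rewrite prE //; exact: mlab_code.
Qed.

Lemma integrable_agree f n c : measurable_fun setT f ->
  (forall u v, agree n u v -> f u - f v <= c) -> nu.-integrable setT (EFin \o f).
Proof.
move=> mf fc; apply: measurable_bounded_integrable => //.
  by apply: (@le_lt_trans _ _ 1%E); [exact: probability_le1|exact: ltry].
pose M := \sum_(w : word I n) `|f (glue d w y0)|.
exists (M + `|c|); split; first exact: num_real.
move=> x Mx y _ /=; apply: le_trans (ltW Mx).
set z := glue d (code e n y) y0.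
have yz : agree n y z by exact: agree_glue_code.
have fz : `|f z| <= M.
  by rewrite /M (bigD1 (code e n y)) //= lerDl; apply: sumr_ge0.
have h1 := fc _ _ yz; have h2 := fc _ _ (agree_sym yz).
have := ler_norm c; have := ler_norm (f z); have := ler_norm (- f z).
by rewrite normrN ler_norml => *; apply/andP; split; lra.
Qed.

Lemma Rintegral_wmean f n c : measurable_fun setT f ->
  (forall u v, agree n u v -> f u - f v <= c) ->
  `|\int[nu]_x f x - wmean n f| <= c.
Proof.
move=> mf fc.
have intf := integrable_agree mf fc.
pose g (w : word I n) := f (glue d w y0).
have intg b := (integral_code (fun w => g w + b)).1.
have gE b : \int[nu]_x (g (code e n x) + b) = wmean n f + b.
  rewrite /Rintegral (integral_code (fun w => g w + b)).2 /=.
  under eq_bigr do rewrite mulrDr.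
  by rewrite big_split -mulr_suml sum_pr ?mul1r //; exact: mlab_code.
have ag x : agree n x (glue d (code e n x) y0) by exact: agree_glue_code.
rewrite ler_norml lerBlDl lerBrDl -gE -gE; apply/andP; split.
  apply: (le_Rintegral measurableT (intg _) intf) => x _; rewrite /g /=.
  by have := fc _ _ (agree_sym (ag x)); lra.
apply: (le_Rintegral measurableT intf (intg _)) => x _; rewrite /g /=.
by have := fc _ _ (ag x); lra.
Qed.

Lemma EFin_Rintegral f n c : measurable_fun setT f ->
  (forall u v, agree n u v -> f u - f v <= c) ->
  (\int[nu]_x (f x)%:E = (\int[nu]_x f x)%R%:E)%E.
Proof.
move=> mf fc; rewrite /Rintegral fineK //.
exact: integrable_fin_num (integrable_agree mf fc).
Qed.

Lemma wmean_le n f g : (forall x, f x <= g x) -> wmean n f <= wmean n g.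
Proof. by move=> fg; apply: ler_sum => w _; rewrite ler_wpM2l ?pr_ge0. Qed.

Lemma wmean_cst n c : wmean n (fun=> c) = c.
Proof. by rewrite /wmean -mulr_suml sum_pr ?mul1r //; exact: mlab_code. Qed.

Section Invariant.
Hypothesis inv : invariant_measure (@shift_map A) nu.

Lemma pr_code_shift n (w : word I n) :
  \sum_(a : I) pr nu (code e n.+1) (a, w) = pr nu (code e n) w.
Proof.
have mc := @mlab_code _ _ e.
have -> : pr nu (code e n) w = pr nu ((fun v : word I n.+1 => v.2) \o code e n.+1) w.
  rewrite /pr -(inv (mc n w)); congr (fine (nu _)).
rewrite pr_comp // (reindex_onto (fun a => (a, w)) fst) /=; last first.
  by move=> [a v] /= /eqP ->.
by apply: eq_bigl => a; rewrite !eqxx.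
Qed.

End Invariant.

End WordMeans.

Section Pressure.
Context {R : realType} {A : pointedType} {k : nat}.
Variables (d : 'I_k -> A) (e : A -> 'I_k).
Hypotheses (de : cancel d e) (ed : cancel e d).
Variables (phi : Omega A -> R) (rem : nat -> R).
Hypothesis phi_rem : forall n u v, agree n u v -> phi u - phi v <= rem n - rem n.+1.
Hypothesis rem_ge0 : forall n, 0 <= rem n.
Hypothesis rem_cvg0 : rem @ \oo --> (0 : R).
Variable y0 : Omega A.

Let Z n := pfun d phi n y0.
Let Z_gt0 n : 0 < Z n. Proof. exact: (pfun_gt0 d e). Qed.

Lemma measurable_phi : measurable_fun setT phi.
Proof.
apply: measurable_fun_agree rem_cvg0 _ => n u v /phi_rem/le_trans; apply.
by rewrite gerBl.
Qed.

Section InvariantMeasure.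
Variable nu : probability (Omega A) R.
Hypothesis inv : invariant_measure (@shift_map A) nu.

Lemma wmean_wsum_le j :
  \sum_w pr nu (code e j) w * wsum d phi w y0 <=
  j%:R * (\int[nu]_x phi x)%R + (rem 1%N - rem j.+1).
Proof.
elim: j => [|j IH]; first by rewrite big1 ?mul0r ?subrr ?addr0 // => w _; rewrite mulr0.
have -> : \sum_w pr nu (code e j.+1) w * wsum d phi w y0 =
    wmean d e nu y0 j.+1 phi + \sum_w pr nu (code e j) w * wsum d phi w y0.
  have -> : \sum_w pr nu (code e j) w * wsum d phi w y0 =
      \sum_(w : word 'I_k j.+1) pr nu (code e j.+1) w * wsum d phi (w.2 : word 'I_k j) y0.
    rewrite (sum_word_S (n := j)) exchange_big /=; apply: eq_bigr => w _.
    by rewrite -(pr_code_shift e inv) mulr_suml.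
  by rewrite /wmean -big_split /=; apply: eq_bigr => w _; rewrite -mulrDr.
have := Rintegral_wmean ed nu y0 measurable_phi (@phi_rem j.+1).
rewrite ler_norml => /andP[h _].
by rewrite -natr1 mulrDl mul1r; lra.
Qed.

Lemma ent_code_le m n : (m <= n)%N -> ent nu (code e m) <= ent nu (code e n).
Proof.
move/subnKC <-; elim: (n - m)%N => [|i IH]; rewrite ?addn0 // addnS.
apply: le_trans IH _; apply: (@ent_le_of _ _ _ nu _ _ _ _ (@wbelast 'I_k (m + i))).
  exact: mlab_code.
by move=> x; exact/esym/wbelast_itin.
Qed.

(** The Gibbs bound makes the entropy of [j]-words at least [ln (Z j)] minus the mean Birkhoff sum,
    up to constants. Supermultiplicativity along multiples of [n] then brings in [ln (Z n)], and the
    remainder modulo [n] is paid by a constant. *)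
Lemma gibbs_pressure_ge c n : (0 < n)%N ->
  (forall j (w : word 'I_k j), pr nu (code e j) w <= expR c * (expR (wsum d phi w y0) / Z j)) ->
  (((ln (Z n) - rem 1%N) / n%:R)%:E <= pressure_functional phi nu)%E.
Proof.
move=> n0 gibbs; set J := (\int[nu]_x phi x)%R.
have n0R : 0 < n%:R :> R by rewrite ltr0n.
pose h := (ln (Z n) - rem 1%N) / n%:R - J.
have entj j : ln (Z j) - c - rem 1%N - j%:R * J <= ent nu (code e j).
  apply: (@le_trans _ _ (\sum_w pr nu (code e j) w * (ln (Z j) - c - wsum d phi w y0))).
    under eq_bigr do rewrite mulrBr.
    rewrite sumrB -mulr_suml sum_pr ?mul1r; last exact: mlab_code.
    by have := wmean_wsum_le j; rewrite -/J; have := rem_ge0 j.+1; lra.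
  rewrite /ent -sumrN; apply: ler_sum => w _; rewrite -mulrN.
  have := pr_ge0 nu (code e j) w; rewrite le_eqVlt => /orP[/eqP <-|pw].
    by rewrite !mul0r.
  rewrite ler_pM2l // lerBlDr -lerBlDl opprK -[leRHS]opprK.
  have := gibbs j w; rewrite -ler_ln ?posrE ?mulr_gt0 ?invr_gt0 ?expR_gt0 //.
  by rewrite lnM ?ln_div ?posrE ?mulr_gt0 ?invr_gt0 ?expR_gt0 // !expRK; lra.
have ml := mlab_letter0 e.
have hP : h <= partition_entropy (@shift_map A) nu (letter0 e).
  apply: (partition_entropy_ge (c := n%:R * `|h| + c + rem 1%N)
    (@measurable_shift A) inv ml) => j.
  rewrite -/(code e j); set q := (j %/ n)%N.
  apply: le_trans (ent_code_le (leq_trunc_div j n)).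
  apply: le_trans (entj _).
  have qZ := ln_pfun_mul d e phi_rem rem_ge0 q n y0.
  have hE : n%:R * h = ln (Z n) - rem 1%N - n%:R * J.
    by rewrite /h mulrBr mulrCA divff ?mulr1 // gt_eqF.
  have jE : j%:R = q%:R * n%:R + (j %% n)%:R :> R.
    by rewrite -natrM -natrD -divn_eq.
  have rn : (j %% n)%:R * h <= n%:R * `|h|.
    apply: (@le_trans _ _ ((j %% n)%:R * `|h|)).
      by rewrite ler_wpM2l ?ler0n // ler_norm.
    by rewrite ler_wpM2r ?normr_ge0 // ler_nat ltnW // ltn_pmod.
  have -> : j%:R * h = q%:R * (n%:R * h) + (j %% n)%:R * h.
    by rewrite {1}jE mulrDl mulrA.
  rewrite hE natrM; move: qZ; rewrite -/(Z n) -/(Z (q * n)%N).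
  nra.
rewrite /pressure_functional.
rewrite (EFin_Rintegral ed nu y0 measurable_phi (@phi_rem 0%N)) -/J.
apply: (@le_trans _ _ (h%:E + J%:E)%E); first by rewrite -EFinD lee_fin subrK.
rewrite leeD2r //; apply: le_trans (ereal_sup_ubound _); last first.
  by exists k, (letter0 e).
by rewrite lee_fin.
Qed.

End InvariantMeasure.

Variable mu : probability (Omega A) R.
Hypothesis mu_eq : equilibrium_state phi mu.

Lemma equilibrium_pressure_ge n M :
  ln (Z n) - rem 1%N <=
  n%:R * (ent mu (code e M.+1) - ent mu (code e M) + (\int[mu]_x phi x)%R).
Proof.
have [-> |n0] := posnP n.
  by rewrite mul0r /Z /pfun /= ln1 sub0r oppr_le0.
have [nu [nu_inv nu_gibbs]] := invariant_gibbs_exists de ed phi_rem rem_ge0 y0.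
have H1 := gibbs_pressure_ge nu_inv n0 nu_gibbs.
have H2 := le_trans H1 (mu_eq.2 nu nu_inv).
have : (((ln (Z n) - rem 1%N) / n%:R)%:E <=
    (ent mu (code e M.+1) - ent mu (code e M) + (\int[mu]_x phi x)%R)%:E)%E.
  apply: le_trans H2 _; rewrite /pressure_functional EFinD.
  rewrite (EFin_Rintegral ed mu y0 measurable_phi (@phi_rem 0%N)) leeD2r //.
  exact: (entropy_le ed mu_eq.1).
by rewrite lee_fin ler_pdivrMr ?ltr0n // mulrC.
Qed.

End Pressure.

(* A weak form of Pinsker's inequality, through the Hellinger distance. *)
Lemma kullback_tv (R : realType) (J : finType) (p q : J -> R) (lam : R) :
  0 < lam -> (forall a, 0 <= p a) -> (forall a, 0 <= q a) ->
  (forall a, 0 < p a -> 0 < q a) -> \sum_a p a = 1 -> \sum_a q a = 1 ->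
  \sum_a `|p a - q a| <=
  (\sum_a p a * (ln (p a) - ln (q a))) / (2 * lam) + 2 * lam.
Proof.
move=> l0 p0 q0 pq p1 q1.
pose s a := Num.sqrt (p a); pose t a := Num.sqrt (q a).
have s0 a : 0 <= s a by exact: sqrtr_ge0.
have t0 a : 0 <= t a by exact: sqrtr_ge0.
have sE a : s a ^+ 2 = p a by exact: sqr_sqrtr.
have tE a : t a ^+ 2 = q a by exact: sqr_sqrtr.
(* The squared Hellinger distance is at most the relative entropy, by [ln x <= x - 1] at
   [x = t a / s a]. *)
have hell : \sum_a (s a - t a) ^+ 2 <= \sum_a p a * (ln (p a) - ln (q a)).
  have -> : \sum_a (s a - t a) ^+ 2 = \sum_a (2 * p a - 2 * (s a * t a)).
    have -> : \sum_a (s a - t a) ^+ 2 =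
        \sum_a (q a - p a) + \sum_a (2 * p a - 2 * (s a * t a)).
      rewrite -big_split /=; apply: eq_bigr => a _.
      by rewrite -sE -tE; ring.
    by rewrite sumrB p1 q1 subrr add0r.
  apply: ler_sum => a _.
  have := p0 a; rewrite le_eqVlt => /orP[/eqP pa|pa].
    have -> : s a = 0 by rewrite /s -pa sqrtr0.
    by rewrite -pa !mul0r !mulr0 subr0.
  have qa := pq _ pa.
  have sa : 0 < s a by rewrite sqrtr_gt0.
  have ta : 0 < t a by rewrite sqrtr_gt0.
  have lnp : ln (p a) = ln (s a) + ln (s a) by rewrite -sE expr2 lnM ?posrE.
  have lnq : ln (q a) = ln (t a) + ln (t a) by rewrite -tE expr2 lnM ?posrE.
  have l1 : ln (t a) - ln (s a) <= t a / s a - 1.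
    rewrite -ln_div ?posrE // -[t a / s a in leLHS](subrK 1) addrC.
    by apply: le_ln1Dx; rewrite ltrBrDl subrr divr_gt0.
  have l2 : p a * (t a / s a) = s a * t a.
    by rewrite -sE; field; rewrite gt_eqF.
  have l3 : p a * (ln (t a) - ln (s a)) <= s a * t a - p a.
    apply: le_trans (ler_wpM2l (p0 a) l1) _.
    by rewrite [X in X <= _]mulrBr mulr1 l2.
  rewrite lnp lnq; nra.
(* Young's inequality with parameter [lam] for the product of the distance of [s a] and [t a] with
   their sum, whose square is at most [2 * (p a + q a)]. *)
apply: (@le_trans _ _ (\sum_a ((s a - t a) ^+ 2 / (2 * lam) + lam * (p a + q a)))).
  apply: ler_sum => a _; rewrite -sE -tE.
  have -> : `|s a ^+ 2 - t a ^+ 2| = `|s a - t a| * (s a + t a).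
    by rewrite subr_sqr normrM [`|s a + t a|]ger0_norm ?addr_ge0.
  have l2 : 0 < 2 * lam by rewrite mulr_gt0.
  rewrite -(ler_pM2r l2) [leRHS]mulrDl divfK ?gt_eqF //.
  rewrite -[(s a - t a) ^+ 2]real_normK ?num_real //.
  have h1 : 0 <= (`|s a - t a| - lam * (s a + t a)) ^+ 2 by exact: sqr_ge0.
  have h2 : 0 <= lam ^+ 2 * (s a - t a) ^+ 2 by rewrite mulr_ge0 ?sqr_ge0.
  nra.
rewrite big_split /= -mulr_suml -mulr_sumr big_split /= p1 q1 [lam * _]mulrC.
by rewrite lerD2r ler_pM2r // invr_gt0 mulr_gt0.
Qed.

(** * Relative entropy of [mu] against the finite-volume kernels *)

Section KullbackStep.
Context {R : realType} {A : pointedType} {I : finType}.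
Variables (d : I -> A) (e : A -> I).
Hypotheses (de : cancel d e) (ed : cancel e d).
Variables (phi : Omega A -> R) (rem tl : nat -> R).
Hypothesis phi_rem : forall n u v, agree n u v -> phi u - phi v <= rem n - rem n.+1.
Hypothesis rem_ge0 : forall n, 0 <= rem n.
Hypothesis rem_tl : forall n, rem n <= tl n - tl n.+1.
Hypothesis tl_ge0 : forall n, 0 <= tl n.
Hypothesis rem_cvg0 : rem @ \oo --> (0 : R).
Variables (y0 : Omega A) (mu : probability (Omega A) R).
Hypothesis inv : invariant_measure (@shift_map A) mu.
Hypothesis pressure_ge : forall n M, ln (pfun d phi n y0) - rem 1%N <=
  n%:R * (ent mu (code e M.+1) - ent mu (code e M) + (\int[mu]_x phi x)%R).
Implicit Types (f F : Omega A -> R).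

Let p M (w : word I M) := pr mu (code e M) w.
Let wm M f := wmean d e mu y0 M f.
Let G i := kstep d (gker d phi i).
Let lnZ i x := ln (pfun d phi i x).

Let kap i M (v : word I M.+1) := gker d phi i v.1 (glue d (v.2 : word I M) y0).

(** Both laws have the same marginal on the last [M] letters, so this is the mean relative entropy
    of the conditional law of the first letter. *)
Definition kullback i M : R :=
  \sum_(v : word I M.+1) p v *
    (ln (p v) - ln (p (v.2 : word I M) * kap i v)).

Let p_le M (v : word I M.+1) : p v <= p (v.2 : word I M).
Proof.
case: v => a w; rewrite /p -(pr_code_shift e inv (n := M) w) (bigD1 a) //= lerDl.
by apply: sumr_ge0 => b _; exact: pr_ge0.
Qed.

Let q_sum i M : \sum_(v : word I M.+1) p (v.2 : word I M) * kap i v = 1.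
Proof.
rewrite (sum_word_S (n := M)) exchange_big /=.
rewrite -(sum_pr mu (@mlab_code _ _ e M)); apply: eq_bigr => w _.
transitivity (p w * \sum_a gker d phi i a (glue d w y0)).
  by rewrite mulr_sumr.
by rewrite (gker_sum d e phi i) mulr1.
Qed.

Let q_pos i M (v : word I M.+1) : 0 < p v -> 0 < p (v.2 : word I M) * kap i v.
Proof.
by move=> pv; rewrite mulr_gt0 ?(gker_gt0 d e) // (lt_le_trans pv) // p_le.
Qed.

Lemma kullback_tv_step i M lam : 0 < lam ->
  \sum_(v : word I M.+1) `|p v - p (v.2 : word I M) * kap i v| <=
  kullback i M / (2 * lam) + 2 * lam.
Proof.
move=> l0; apply: kullback_tv => //.
- by move=> v; exact: pr_ge0.
- by move=> v; rewrite mulr_ge0 ?pr_ge0 // ltW // (gker_gt0 d e).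
- by move=> v; exact: q_pos.
- by rewrite sum_pr //; exact: mlab_code.
Qed.

Lemma kullback_ge0 i M : 0 <= kullback i M.
Proof.
rewrite -oppr_le0 /kullback.
have := @gibbs_inequality R (word I M.+1) (@p M.+1)
  (fun v => p (v.2 : word I M) * kap i v).
move=> /(_ (pr_ge0 _ _) _ (@q_pos i M)).
rewrite q_sum sum_pr; last exact: mlab_code.
move=> H; have {}H := H _ (lexx 1).
under eq_bigr do rewrite mulrBr.
rewrite sumrB opprB -[X in X <= 0]opprK opprB oppr_le0 subr_ge0 -lerN2.
by apply: H => v; rewrite mulr_ge0 ?pr_ge0 // ltW // (gker_gt0 d e).
Qed.

Let lnZ_agree i l u v : agree l u v -> lnZ i u - lnZ i v <= rem l.+1.
Proof. exact: (ln_pfun_agree d e phi_rem rem_ge0). Qed.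

Let measurable_lnZ i : measurable_fun setT (lnZ i).
Proof.
apply: (measurable_fun_agree (om := fun n => rem n.+1)).
  by rewrite (cvg_shiftS rem).
by move=> n u v; exact: lnZ_agree.
Qed.

(** The logarithm of the kernel is [phi] plus a difference of [lnZ i] and [lnZ i.+1]. The error
    covers three frozen tails: those of [phi] and [lnZ i] at depth [M.+1], and that of [lnZ i] at
    depth [M]. *)
Lemma kullback_le i M : kullback i M <=
  wm M (lnZ i.+1) - wm M (lnZ i) + 3 * rem M.+1 -
  (ent mu (code e M.+1) - ent mu (code e M) + (\int[mu]_x phi x)%R).
Proof.
have -> : kullback i M = ent mu (code e M) - ent mu (code e M.+1) -
    (wm M.+1 phi + wm M.+1 (lnZ i) - wm M (lnZ i.+1)).
  have marg (g : word I M -> R) :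
      \sum_(v : word I M.+1) p v * g (v.2 : word I M) = \sum_w p w * g w.
    rewrite (sum_word_S (n := M)) exchange_big /=; apply: eq_bigr => w _.
    by rewrite /p -(pr_code_shift e inv (n := M) w) mulr_suml.
  have -> : ent mu (code e M) = - \sum_(v : word I M.+1) p v * ln (p (v.2 : word I M)).
    by rewrite (marg (fun w => ln (p w))).
  have -> : wm M (lnZ i.+1) =
      \sum_(v : word I M.+1) p v * lnZ i.+1 (glue d (v.2 : word I M) y0).
    by rewrite (marg (fun w => lnZ i.+1 (glue d w y0))).
  rewrite /ent /wm /wmean -/(@p M.+1) -sumrN -[X in _ - X - _]sumrN.
  rewrite -sumrB -big_split -!sumrB /=; apply: eq_bigr => v _.
  have := pr_ge0 mu (code e M.+1) v; rewrite -/(p v) le_eqVlt => /orP[/eqP <-|pv].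
    by rewrite !mul0r; ring.
  have pw := lt_le_trans pv (p_le v).
  rewrite lnM ?posrE ?(gker_gt0 d e) // /kap ln_gker //.
  by rewrite /lnZ /=; ring.
have := Rintegral_wmean ed mu y0 (measurable_phi phi_rem rem_ge0 rem_cvg0) (@phi_rem M.+1).
have := Rintegral_wmean ed mu y0 (measurable_lnZ i) (@lnZ_agree i M.+1).
have := Rintegral_wmean ed mu y0 (measurable_lnZ i) (@lnZ_agree i M).
rewrite -/(wm M _) -/(wm M.+1 _) -/(wm M.+1 _) !ler_norml => /andP[h1 h2] /andP[h3 h4] /andP[h5 h6].
have := rem_noninc phi_rem M.+1; have := rem_ge0 M.+2; lra.
Qed.

(* The sum over [i] telescopes: the relative entropies stay bounded on average
   because [ln (pfun n)] exceeds [n] times the pressure of [mu] by a constant. *)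
Lemma sum_kullback_le n M :
  \sum_(i < n) kullback i M <= 2 * rem 1%N + n%:R * (3 * rem M.+1).
Proof.
have step : \sum_(i < n) kullback i M <= wm M (lnZ n) - wm M (lnZ 0) +
    n%:R * (3 * rem M.+1 -
    (ent mu (code e M.+1) - ent mu (code e M) + (\int[mu]_x phi x)%R)).
  elim: n => [|n IH]; first by rewrite big_ord0 subrr mul0r addr0.
  rewrite big_ord_recr /= -natr1 mulrDl mul1r.
  by have := kullback_le n M; move: IH; lra.
have Z0 : wm M (lnZ 0) = 0.
  rewrite /wm /wmean big1 // => w _.
  by rewrite /lnZ /pfun /= ln1 mulr0.
have Zn : wm M (lnZ n) <= lnZ n y0 + rem 1%N.
  rewrite -[leRHS](wmean_cst d e mu y0 M) ; apply: wmean_le => x.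
  by rewrite -lerBlDl; apply: (@lnZ_agree n 0).
have := pressure_ge n M; rewrite -/(lnZ n y0).
move: step; rewrite Z0 mulrBr; lra.
Qed.

(** One [i] has to serve [N] depths at once, so the sum over [j] is averaged over [n] values of
    [i]. *)
Lemma small_kullback N (eps : R) : 0 < eps ->
  exists M i, forall j, (j < N)%N -> kullback i (M + j) <= eps.
Proof.
move=> eps0.
have N1 : 0 < N.+1%:R :> R by rewrite ltr0n.
(* [M] keeps the part proportional to [n] below [n * eps / 2]; [n] is then taken so large that the
   bounded part is smaller than the other half. *)
have e1 : 0 < eps / 2 / (3 * N.+1%:R) by rewrite !divr_gt0 // mulr_gt0.
have /cvgrPdist_le/(_ _ e1)[M _ MP] := rem_cvg0.
have remM j : 3 * N.+1%:R * rem (M + j).+1 <= eps / 2.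
  have := MP (M + j).+1; rewrite /= sub0r normrN ger0_norm //.
  move=> /(_ (leqW (leq_addr _ _))).
  by rewrite ler_pdivlMr ?mulr_gt0 // mulrC.
pose n := (Num.truncn (2 * (N.+1%:R * (2 * rem 1%N)) / eps)).+1.
have nP : N.+1%:R * (2 * rem 1%N) < n%:R * (eps / 2).
  have : 2 * (N.+1%:R * (2 * rem 1%N)) / eps < n%:R.
    exact: truncnS_gt.
  rewrite ltr_pdivrMr // => H; nra.
exists M; apply: contrapT => H.
have {}H i : eps < \sum_(j < N.+1) kullback i (M + j).
  rewrite ltNge; apply/negP => Hi; apply: H; exists i => j jN.
  apply: le_trans Hi; rewrite (bigD1 (Ordinal (ltnW jN : (j < N.+1)%N))) //= lerDl.
  by apply: sumr_ge0 => l _; exact: kullback_ge0.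
have : n%:R * eps <= \sum_(i < n) \sum_(j < N.+1) kullback i (M + j).
  have -> : n%:R * eps = \sum_(i < n) eps by rewrite sumr_const card_ord mulr_natl.
  by apply: ler_sum => i _; exact/ltW/H.
apply/negP; rewrite -ltNge exchange_big /=.
apply: (@le_lt_trans _ _ (\sum_(j < N.+1) (2 * rem 1%N + n%:R * (eps / 2 / N.+1%:R)))).
  apply: ler_sum => j _; apply: le_trans (sum_kullback_le _ _) _.
  rewrite lerD2l ler_wpM2l ?ler0n // ler_pdivlMr //.
  by have := remM j; rewrite -mulrA [N.+1%:R * _]mulrC mulrA.
have -> : \sum_(j < N.+1) (2 * rem 1%N + n%:R * (eps / 2 / N.+1%:R)) =
    N.+1%:R * (2 * rem 1%N) + n%:R * (eps / 2).
  rewrite sumr_const card_ord -[_ *+ _]mulr_natl.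
  by move: (lt0r_neq0 N1); set x := N.+1%:R => xn; field.
by lra.
Qed.

Lemma kstep_bound i f B x : (forall z, `|f z| <= B) -> `|G i f x| <= B.
Proof.
move=> fB; apply: le_trans (ler_norm_sum _ _ _) _.
apply: (@le_trans _ _ (\sum_a gker d phi i a x * B)).
  apply: ler_sum => a _; have g0 := ltW (gker_gt0 d e phi i a x).
  by rewrite normrM ger0_norm // ler_wpM2l.
by rewrite -mulr_suml (gker_sum d e) mul1r.
Qed.

Lemma wmean_kstep i M f B eps : 0 < eps -> 0 <= B -> (forall x, `|f x| <= B) ->
  kullback i M <= eps ^+ 2 ->
  `|wm M.+1 f - wm M (G i f)| <= B * (3 * eps).
Proof.
move=> eps0 B0 fB kl.
have -> : wm M (G i f) =
    \sum_(v : word I M.+1) p (v.2 : word I M) * kap i v * f (glue d v y0).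
  rewrite (sum_word_S (n := M)) exchange_big /=; apply: eq_bigr => w _.
  by rewrite mulr_sumr; apply: eq_bigr => a _; rewrite mulrA.
rewrite /wm /wmean -sumrB; apply: le_trans (ler_norm_sum _ _ _) _.
apply: (@le_trans _ _ (\sum_(v : word I M.+1)
    B * `|p v - p (v.2 : word I M) * kap i v|)).
  apply: ler_sum => v _; rewrite -mulrBl normrM mulrC.
  by rewrite ler_wpM2r ?normr_ge0.
rewrite -mulr_sumr ler_wpM2l //; apply: le_trans (kullback_tv_step _ _ eps0) _.
have : kullback i M / (2 * eps) <= eps.
  by rewrite ler_pdivrMr ?mulr_gt0 //; nra.
lra.
Qed.

(** The letters are redrawn one by one from the front, each at its own depth [M + j]; [G i] does not
    increase sup bounds, so the errors add up. *)
Lemma wmean_kstep_iter i M N f B eps : 0 < eps -> 0 <= B ->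
  (forall x, `|f x| <= B) ->
  (forall j, (j < N)%N -> kullback i (M + j) <= eps ^+ 2) ->
  `|wm (M + N) f - wm M (iter N (G i) f)| <= N%:R * (B * (3 * eps)).
Proof.
move=> eps0 B0; elim: N f => [|N IH] f fB kl.
  by rewrite addn0 subrr normr0 mul0r.
rewrite iterSr addnS -natr1 mulrDl mul1r [leRHS]addrC.
apply: le_trans (ler_distD (wm (M + N) (G i f)) _ _) _; apply: lerD.
  by apply: wmean_kstep => //; exact: kl.
apply: IH => [x|j jN]; first exact: kstep_bound.
by apply: kl; exact: ltnW.
Qed.

Lemma finite_range_concentration N F (delta : nat -> R) :
  (forall j, 0 <= delta j) ->
  (forall u v, F u - F v <= \sum_(j < N) delta j * (u j != v j)%:R) ->
  (\int[mu]_x expR (F x))%R <=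
  expR ((\int[mu]_x F x)%R +
        2 * (expR (2 * tl 0%N) ^+ 2 * \sum_(j < N.+1) delta j ^+ 2)).
Proof.
move=> delta0 Fdelta; set V := 2 * _.
pose S := \sum_(j < N) delta j.
have osc u v : F u - F v <= S.
  apply: le_trans (Fdelta u v) _; apply: ler_sum => j _.
  by rewrite -[leRHS]mulr1 ler_wpM2l //; case: (_ != _) => //; exact: ler01.
have FN u v : agree N u v -> F u - F v <= 0.
  move=> uv; apply: le_trans (Fdelta u v) _.
  by rewrite big1 // => j _; rewrite uv // eqxx mulr0.
have FNE u v : agree N u v -> F u = F v.
  move=> uv; have := FN _ _ uv; have := FN _ _ (agree_sym uv).
  by move=> *; apply/le_anti/andP; split; lra.
pose B := `|F y0| + S.
have FB x : `|F x| <= B.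
  have := osc x y0; have := osc y0 x; have := ler_norm (F y0).
  have := ler_norm (- F y0); rewrite normrN /B ler_norml => *.
  by apply/andP; split; lra.
have B0 : 0 <= B := le_trans (normr_ge0 _) (FB y0).
have eB x : `|expR (F x)| <= expR B.
  by rewrite ger0_norm ?expR_ge0 // ler_expR; exact: le_trans (ler_norm _) (FB x).
(* A function of [N] letters has no tail error: its [wm (M + N)] is its integral. *)
have cyl (f : Omega A -> R) : (forall u v, agree N u v -> f u = f v) ->
    forall M, wm (M + N) f = (\int[mu]_x f x)%R.
  move=> fN M.
  have f0 u v : agree (M + N) u v -> f u - f v <= 0.
    by move=> uv; rewrite (fN u v) ?subrr //; exact: agree_leq (leq_addl _ _) uv.
  have mf : measurable_fun setT f.
    apply: (measurable_fun_agree (om := fun n => if (n < N)%N then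
       \sum_(w : word I N) `|f (glue d w y0)| *+ 2 else 0)).
      apply: (@cvg_near_cst _ _ _ _ _) => //.
      by exists N => // n /= Nn; rewrite ltnNge Nn.
    move=> n u v uv; case: ifP => nN; last first.
      by rewrite (fN u v) ?subrr //; apply: agree_leq uv; rewrite leqNgt nN.
    have fE x : f x <= \sum_(w : word I N) `|f (glue d w y0)| /\
        - f x <= \sum_(w : word I N) `|f (glue d w y0)|.
      rewrite (fN x _ (agree_glue_code (n := N) ed x y0)).
      have fle : `|f (glue d (code e N x) y0)| <=
          \sum_(w : word I N) `|f (glue d w y0)|.
        by rewrite [leRHS](bigD1 (code e N x)) //= lerDl; apply: sumr_ge0.
      split; apply: le_trans fle; first exact: ler_norm.
      by rewrite -normrN ler_norm.
    have [h1 _] := fE u; have [_ h2] := fE v.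
    by rewrite sumrMnl mulr2n; lra.
  have := Rintegral_wmean ed mu y0 mf f0.
  by rewrite normr_le0 subr_eq0 => /eqP.
have eFN u v : agree N u v -> expR (F u) = expR (F v) by move=> /FNE ->.
(* [M] and [i] depend on [eps], but [V], [B] and [N] do not, so [eps] can tend to zero
   afterwards. *)
have main eps : 0 < eps -> (\int[mu]_x expR (F x))%R <=
    expR ((\int[mu]_x F x)%R + V + N%:R * (B * 3) * eps) + N%:R * (expR B * 3) * eps.
  move=> eps0; have eps2 : 0 < eps ^+ 2 by exact: exprn_gt0.
  have [M [i kl]] := small_kullback N eps2.
  have h1 := wmean_kstep_iter eps0 (expR_ge0 B) eB kl.
  have h2 := wmean_kstep_iter eps0 B0 FB kl.
  rewrite (cyl _ eFN) in h1; rewrite (cyl _ FNE) in h2.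
  have := mixture_mgf d (fun a y => ltW (gker_gt0 d e phi i a y)) (gker_sum d e phi i)
    (gker_rho01 rem_ge0) (fun l a u v => @gker_agree _ _ _ d e _ _ phi_rem rem_ge0 i l a u v)
    (gker_survive01 tl_ge0) (gker_survive_rho phi_rem rem_tl)
    delta0 Fdelta (fun w : word I M => glue d w y0)
    (pr_ge0 mu (code e M)) (sum_pr mu (@mlab_code _ _ e M)).
  have -> : gker_survive tl 0 ^- 2 = expR (2 * tl 0%N) ^+ 2.
    by rewrite /gker_survive -exprVn -expRN opprK.
  rewrite -/V -/(wmean d e mu y0 M _) -/(wm M _) -/(wmean d e mu y0 M _) -/(wm M _) -/(G i).
  move=> h3; move: h1 h2; rewrite !ler_norml => /andP[_ h1] /andP[h2 _].
  have -> : N%:R * (expR B * 3) * eps = N%:R * (expR B * (3 * eps)) by ring.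
  rewrite -lerBlDr; apply: (@le_trans _ _ (wm M (iter N (G i) (expR \o F)))); first lra.
  apply: le_trans h3 _; rewrite ler_expR.
  have -> : N%:R * (B * 3) * eps = N%:R * (B * (3 * eps)) by ring.
  lra.
set a := N%:R * (B * 3) in main; set b := N%:R * (expR B * 3) in main.
have lim : (fun n : nat => expR ((\int[mu]_x F x)%R + V + a * n.+1%:R^-1) +
    b * n.+1%:R^-1) @ \oo --> expR ((\int[mu]_x F x)%R + V).
  have h0 := @cvg_harmonic R.
  rewrite -[X in _ --> X]addr0; apply: cvgD; last first.
    by rewrite -(mulr0 b); apply: cvgM => //; exact: cvg_cst.
  apply: continuous_cvg; first exact: continuous_expR.
  rewrite -[X in _ --> X]addr0; apply: cvgD; first exact: cvg_cst.
  by rewrite -(mulr0 a); apply: cvgM => //; exact: cvg_cst.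
have cv : cvgn (fun n : nat => expR ((\int[mu]_x F x)%R + V + a * n.+1%:R^-1) +
    b * n.+1%:R^-1) by apply/cvg_ex; eexists; exact: lim.
rewrite -(cvg_lim (@norm_hausdorff _ R) lim); apply: limr_ge => //.
by apply: nearW => n; apply: main; rewrite invr_gt0 ltr0n.
Qed.

End KullbackStep.

(** * Regularity of the potential *)

Section PowerTails.
Context {R : realType}.
Implicit Types s c : R.

(** The power of [n + 1] with exponent [- s]. *)
Definition pow_tail s (n : nat) : R := expR (- (s * ln n.+1%:R)).

Lemma pow_tail_ge0 s n : 0 <= pow_tail s n. Proof. exact: expR_ge0. Qed.

(** With [m = n.+1], the ratio of consecutive terms is at most [(1 + s / (m + 1))^-1], so the
    relative drop is at least [s / (m + 1 + s)], and [m + 1 + s <= (2 + s) * m]. *)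
Lemma pow_tail_diff s n : 0 < s ->
  s / (2 + s) * pow_tail (s + 1) n <= pow_tail s n - pow_tail s n.+1.
Proof.
move=> s0.
pose m : R := n.+1%:R.
have m1 : 1 <= m by rewrite ler1n.
have m0 : 0 < m by rewrite (lt_le_trans ltr01).
have mS : n.+2%:R = m + 1 :> R by rewrite /m natr1.
have lnm : ln m - ln (m + 1) <= - (m + 1)^-1.
  rewrite -ln_div ?posrE ?addr_gt0 //.
  have -> : m / (m + 1) = 1 + - (m + 1)^-1.
    by field; rewrite gt_eqF // addr_gt0.
  apply: le_ln1Dx; rewrite ltrN2 invf_lt1 ?addr_gt0 //; lra.
have rE : pow_tail s n.+1 = pow_tail s n * expR (s * (ln m - ln (m + 1))).
  by rewrite /pow_tail -expRD mS -/m; congr expR; ring.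
pose x := s / (m + 1).
have x0 : 0 < x by rewrite divr_gt0 // addr_gt0.
have ex : expR (s * (ln m - ln (m + 1))) <= (1 + x)^-1.
  apply: (@le_trans _ _ (expR (- x))).
    by rewrite ler_expR /x -mulrN ler_pM2l.
  rewrite expRN lef_pV2 ?posrE ?expR_gt0 ?addr_gt0 //; exact: expR_ge1Dx.
have pE : pow_tail (s + 1) n = pow_tail s n / m.
  rewrite -[in RHS](lnK (x := m)) ?posrE // -expRN.
  by rewrite /pow_tail -expRD -/m; congr expR; ring.
have p0 := pow_tail_ge0 s n.
rewrite rE pE -[X in X - _]mulr1 -mulrBr mulrCA ler_wpM2l //.
have key : s / (2 + s) / m <= 1 - (1 + x)^-1.
  have -> : 1 - (1 + x)^-1 = s / (m + 1 + s).
    rewrite /x; field; rewrite !gt_eqF //; nra.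
  rewrite -mulrA -invfM ler_pM2l // lef_pV2 ?posrE; nra.
by apply: le_trans key _; rewrite lerD2l lerN2.
Qed.

Lemma pow_tail_le s t n : s <= t -> pow_tail t n <= pow_tail s n.
Proof.
move=> st; rewrite ler_expR lerN2 ler_wpM2r // ln_ge0 // ler1n //.
Qed.

Lemma pow_tail1 n : pow_tail 1 n = n.+1%:R^-1.
Proof. by rewrite /pow_tail mul1r expRN lnK // posrE ltr0n. Qed.

End PowerTails.

Section Potential.
Context {R : realType} {A : pointedType}.
Hypothesis Afin : finite_set [set: A].

Lemma finite_alphabet : exists k (d : 'I_k -> A) (e : A -> 'I_k),
  cancel d e /\ cancel e d.
Proof.
have /finite_seqP[s0 s0E] := Afin.
pose s := undup s0; have us : uniq s by exact: undup_uniq.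
have sA a : a \in s.
  by rewrite mem_undup; have : [set: A] a by []; rewrite s0E.
have es a : (index a s < size s)%N by rewrite index_mem.
exists (size s), (fun i => nth point s i), (fun a => Ordinal (es a)); split.
  by move=> i; apply/val_inj => /=; rewrite index_uniq.
by move=> a /=; rewrite nth_index.
Qed.

Lemma compact_Omega : compact [set: Omega A].
Proof.
have cA : compact [set: discrete_topology A].
  exact: (@finite_compact (discrete_topology A) setT Afin).
have := @tychonoff nat (fun=> discrete_topology A) (fun=> setT).
move=> /(_ (fun _ => cA)).
congr compact; exact/seteqP.
Qed.

Variable phi : Omega A -> R.
Hypothesis phi_cont : continuous phi.

Lemma potential_bounded : exists B, forall x, `|phi x| <= B.
Proof.
have : compact (phi @` setT).
  apply: continuous_compact compact_Omega.
  exact: continuous_subspaceT.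
move=> /compact_bounded[M [_ MP]]; exists (M + 1) => x.
by apply: (MP (M + 1)); [rewrite ltrDl|exists x].
Qed.

Lemma potential_varP n u v : agree n u v -> phi u - phi v <= potential_var phi n.
Proof.
move=> uv; have [B BP] := potential_bounded.
apply: le_trans (ler_norm _) _; apply: ub_le_sup; last by exists u, v.
exists (B + B) => _ [x [y [_ ->]]].
by apply: le_trans (ler_normB _ _) _; exact: lerD.
Qed.

Lemma potential_var_le B n : (forall x, `|phi x| <= B) -> potential_var phi n <= B + B.
Proof.
move=> BP; apply: ge_sup.
  by exists `|phi point - phi point|, point, point.
move=> _ [x [y [_ ->]]].
by apply: le_trans (ler_normB _ _) _; exact: lerD.
Qed.

(** Each summation lowers the exponent by one: [alpha] for the variations, [alpha - 1] for [rem],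
    and [alpha - 2], still positive, for [tl]. *)
Lemma potential_tail : (exists2 alpha : R, 2 < alpha &
      potential_var phi =O_\oo (fun n : nat => n%:R `^ (- alpha))) ->
  exists rem tl : nat -> R,
   [/\ forall n u v, agree n u v -> phi u - phi v <= rem n - rem n.+1,
      forall n, 0 <= rem n,
      forall n, rem n <= tl n - tl n.+1,
      forall n, 0 <= tl n &
      rem @ \oo --> (0 : R)].
Proof.
move=> [alpha a2 vO].
have [C C0 CP] : exists2 C, 0 < C & forall n, potential_var phi n <= C * pow_tail alpha n.
  have [B BP] := potential_bounded.
  have B0 : 0 <= B := le_trans (normr_ge0 _) (BP point).
  have [c c0 [N _ NP]] : exists2 c : R, 0 < c & \forall n \near \oo,
      `|potential_var phi n| <= c * `|n%:R `^ (- alpha)|.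
    by move/eqO_exP : vO.
  (* The first summand serves large [n], where [n.+1 <= 2 * n] compares the two powers; the second
     serves the finitely many [n <= N], through the sup bound [B]. *)
  exists (c * expR (alpha * ln 2) + (B + B) * expR (alpha * ln N.+1%:R)).
    by rewrite ltr_wpDr ?mulr_gt0 ?expR_gt0 // mulr_ge0 ?expR_ge0 // addr_ge0.
  move=> n; rewrite mulrDl.
  have [nN|Nn] := ltnP n N.+1.
    apply: ler_wpDl; first by rewrite !mulr_ge0 ?expR_ge0 // ltW.
    apply: le_trans (potential_var_le n BP) _.
    rewrite -mulrA -[leLHS]mulr1 ler_wpM2l ?addr_ge0 //.
    rewrite /pow_tail -expRD -[leLHS]expR0 ler_expR -mulrBr mulr_ge0 //; first lra.
    by rewrite subr_ge0 ler_ln ?posrE ?ltr0n // ler_nat.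
  apply: ler_wpDr; first by rewrite !mulr_ge0 ?expR_ge0 // addr_ge0.
  have n0 : (0 < n)%N by exact: leq_ltn_trans Nn.
  apply: le_trans (ler_norm _) _; apply: le_trans (NP n (ltnW Nn)) _.
  rewrite -mulrA ler_pM2l // ger0_norm ?powR_ge0 //.
  rewrite /powR pnatr_eq0 gtn_eqF // /pow_tail -expRD ler_expR.
  have : ln n.+1%:R <= ln 2 + ln n%:R :> R.
    rewrite -lnM ?posrE ?ltr0n // -natrM ler_ln ?posrE ?ltr0n ?muln_gt0 //.
    by rewrite ler_nat mul2n -addnn -addn1 leq_add2l.
  nra.
pose s1 := alpha - 1; pose s2 := alpha - 2.
have s1_gt0 : 0 < s1 by rewrite /s1; lra.
have s2_gt0 : 0 < s2 by rewrite /s2; lra.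
pose c1 := C * ((2 + s1) / s1); pose c2 := c1 * ((2 + s2) / s2).
have c1_gt0 : 0 < c1 by rewrite mulr_gt0 // divr_gt0 // addr_gt0.
have c2_gt0 : 0 < c2 by rewrite mulr_gt0 // divr_gt0 // addr_gt0.
have step (s c : R) n : 0 < s -> 0 < c -> c * pow_tail (s + 1) n <=
    c * ((2 + s) / s) * pow_tail s n - c * ((2 + s) / s) * pow_tail s n.+1.
  move=> s0 c0; rewrite -mulrBr -mulrA ler_pM2l //.
  rewrite -ler_pdivrMl ?divr_gt0 ?addr_gt0 //.
  by rewrite invf_div; exact: pow_tail_diff.
exists (fun n => c1 * pow_tail s1 n), (fun n => c2 * pow_tail s2 n); split.
- move=> n u v uv; apply: le_trans (potential_varP uv) _.
  apply: le_trans (CP n) _.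
  by have := step s1 C n s1_gt0 C0; rewrite {1}/s1 subrK.
- by move=> n; rewrite mulr_ge0 ?pow_tail_ge0 // ltW.
- move=> n; have := step s2 c1 n s2_gt0 c1_gt0.
  by have -> : s2 + 1 = s1 by rewrite /s1 /s2; ring.
- by move=> n; rewrite mulr_ge0 ?pow_tail_ge0 // ltW.
- apply: (@squeeze_cvgr _ _ _ _ (fun=> 0) (fun n => c1 * n.+1%:R^-1)).
  + apply: nearW => n; rewrite mulr_ge0 ?pow_tail_ge0 ?(ltW c1_gt0) //=.
    rewrite -pow_tail1 ler_pM2l //; apply: pow_tail_le; rewrite /s1; lra.
  + exact: cvg_cst.
  + rewrite -(mulr0 c1); apply: cvgM; first exact: cvg_cst.
    exact: cvg_harmonic.
Qed.

End Potential.

(** * Separately Lipschitz observables *)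

Section LipschitzObservable.
Context {R : realType} {A : pointedType}.
Variables (theta : R) (n : nat) (K : ('I_n -> Omega A) -> R).
Hypotheses (theta_gt0 : 0 < theta) (theta_lt1 : theta < 1).
Hypothesis K_lip : separately_lipschitz theta K.
Implicit Types (x y : Omega A) (u v : 'I_n -> Omega A).

Let theta_ge0 : 0 <= theta := ltW theta_gt0.
Let theta_le1 : theta <= 1 := ltW theta_lt1.

Lemma dtheta_ge0 x y : 0 <= dtheta theta x y.
Proof. by rewrite /dtheta; case: pselect => // xy; rewrite exprn_ge0. Qed.

Lemma dtheta_agree N x y : agree N x y -> dtheta theta x y <= theta ^+ N.
Proof.
move=> xy; rewrite /dtheta; case: pselect => [H|_]; last by rewrite exprn_ge0.
case: ex_minnP => m xym _.
have Nm : (N <= m)%N.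
  by rewrite leqNgt; apply/negP => /xy E; move: xym; rewrite E eqxx.
by rewrite -(subnKC Nm) exprD ler_piMr ?exprn_ge0 ?exprn_ile1.
Qed.

Lemma dtheta_sum N x y : (forall i, (N <= i)%N -> x i = y i) ->
  dtheta theta x y <= \sum_(i < N) theta ^+ i * (x i != y i)%:R.
Proof.
move=> xy; have s0 : forall i : 'I_N, true -> 0 <= theta ^+ i * (x i != y i)%:R.
  by move=> i _; rewrite mulr_ge0 ?exprn_ge0 ?ler0n.
rewrite /dtheta; case: pselect => [H|_]; last exact: sumr_ge0.
case: ex_minnP => m xym _.
have mN : (m < N)%N.
  by rewrite ltnNge; apply/negP => /xy E; move: xym; rewrite E eqxx.
rewrite (bigD1 (Ordinal mN)) //= xym mulr1 lerDl.
by apply: sumr_ge0 => i _; exact: s0.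
Qed.

Lemma lipschitz_constant_ge0 j : 0 <= lipschitz_constant theta K j.
Proof. by apply: lb_le_inf; [exact: K_lip | move=> L []]. Qed.

Lemma lipschitz_constantP j u v : (forall i, i != j -> u i = v i) ->
  `|K u - K v| <= lipschitz_constant theta K j * dtheta theta (u j) (v j).
Proof.
move=> uv; have [L0 [_ L0P]] := K_lip j.
(* At distance [0] one cannot divide, but any admissible bound [L0] already gives the claim. *)
have := dtheta_ge0 (u j) (v j); rewrite le_eqVlt => /orP[/eqP d0|d0].
  by rewrite -d0 mulr0; have := L0P _ _ uv; rewrite -d0 mulr0.
rewrite -ler_pdivrMr //; apply: lb_le_inf; first exact: K_lip.
by move=> L [_ LP]; rewrite ler_pdivrMr //; exact: LP.
Qed.

Lemma lipschitz_sum u v :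
  K u - K v <= \sum_(j < n) lipschitz_constant theta K j * dtheta theta (u j) (v j).
Proof.
pose h (m : nat) : 'I_n -> Omega A := fun i => if (i < m)%N then v i else u i.
have h0 : h 0%N = u by apply/funext.
have hn : h n = v by apply/funext => i; rewrite /h ltn_ord.
suff H m : (m <= n)%N -> K u - K (h m) <= \sum_(j < n | (j < m)%N)
    lipschitz_constant theta K j * dtheta theta (u j) (v j).
  have := H n (leqnn n); rewrite hn => /le_trans; apply.
  by rewrite le_eqVlt; apply/orP; left; apply/eqP/eq_bigl => j; rewrite ltn_ord.
elim: m => [_|m IH mn]; first by rewrite h0 subrr big_pred0.
pose jm := Ordinal mn.
rewrite (bigD1 jm) //=.
have -> : \sum_(j < n | (j < m.+1)%N && (j != jm))
    lipschitz_constant theta K j * dtheta theta (u j) (v j) =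
    \sum_(j < n | (j < m)%N) lipschitz_constant theta K j * dtheta theta (u j) (v j).
  by apply: eq_bigl => j; rewrite ltnS ltn_neqAle andbC.
have hj : `|K (h m) - K (h m.+1)| <=
    lipschitz_constant theta K jm * dtheta theta (u jm) (v jm).
  have -> : u jm = h m jm by rewrite /h /= ltnn.
  have -> : v jm = h m.+1 jm by rewrite /h /= ltnSn.
  apply: lipschitz_constantP => i im.
  rewrite /h ltnS (leq_eqVlt i m); have -> // : (i == m :> nat) = false.
  by apply/negbTE; exact: im.
have := IH (ltnW mn); have := ler_norm (K (h m) - K (h m.+1)); move: hj; lra.
Qed.

(** Extension by zero, so that the constants can enter a convolution over all letters. *)
Definition lip_seq (j : nat) : R :=
  if insub j is Some i then lipschitz_constant theta K i else 0.

Lemma lip_seq_ord (j : 'I_n) : lip_seq j = lipschitz_constant theta K j.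
Proof. by rewrite /lip_seq valK. Qed.

Lemma lip_seq_out j : (n <= j)%N -> lip_seq j = 0.
Proof. by move=> nj; rewrite /lip_seq insubF // ltnNge nj. Qed.

Lemma lip_seq_ge0 j : 0 <= lip_seq j.
Proof. by rewrite /lip_seq; case: insubP => // i _ _; exact: lipschitz_constant_ge0. Qed.

Lemma sum_lip_seq (g : nat -> R -> R) N : (n <= N)%N -> (forall j, g j 0 = 0) ->
  \sum_(j < n) g j (lipschitz_constant theta K j) = \sum_(j < N) g j (lip_seq j).
Proof.
move=> nN g0; transitivity (\sum_(j < n) g j (lip_seq j)).
  by apply: eq_bigr => j _; rewrite lip_seq_ord.
rewrite (big_ord_widen N (fun j => g j (lip_seq j))) // big_mkcond.
apply: eq_bigr => j _; case: ifP => // /negbT; rewrite -leqNgt => nj.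
by rewrite lip_seq_out.
Qed.

Lemma iter_shift j x i : iter j (@shift_map A) x i = x (j + i)%N.
Proof. by elim: j x => [|j IH] x //; rewrite iterSr IH addSn. Qed.

Lemma orbit_modulus N x y : agree N x y ->
  K (orbit_segment n x) - K (orbit_segment n y) <= (\sum_(j < n) lipschitz_constant theta K j) * theta ^+ (N - n)%N.
Proof.
move=> xy; apply: le_trans (lipschitz_sum _ _) _.
rewrite mulr_suml; apply: ler_sum => j _.
rewrite ler_wpM2l ?lipschitz_constant_ge0 // /orbit_segment.
apply: (@le_trans _ _ (theta ^+ (N - j))).
  apply: dtheta_agree => i iN; rewrite !iter_shift; apply: xy.
  by rewrite -ltn_subRL.
have jn : (N - n <= N - j)%N by apply: leq_sub2l; exact: ltnW.
by rewrite -(subnKC jn) exprD ler_piMr ?exprn_ge0 ?exprn_ile1.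
Qed.

(** The [j]-th shift sees the letter at position [k] at depth [k - j], hence the weight
    [theta ^+ (k - j)]: Lipschitz bounds in each point become oscillation bounds in each letter. *)
Lemma orbit_hamming N x y : (n <= N)%N -> (forall i, (N <= i)%N -> x i = y i) ->
  K (orbit_segment n x) - K (orbit_segment n y) <=
  \sum_(k < N) causal_conv (fun s => theta ^+ s) lip_seq k * (x k != y k)%:R.
Proof.
move=> nN xy; apply: le_trans (lipschitz_sum _ _) _.
have -> : \sum_(j < n) lipschitz_constant theta K j *
      dtheta theta (orbit_segment n x j) (orbit_segment n y j) =
    \sum_(j < N) lip_seq j *
      dtheta theta (iter j (@shift_map A) x) (iter j (@shift_map A) y).
  apply: (sum_lip_seq (g := fun j l => l * dtheta theta (iter j (@shift_map A) x)
    (iter j (@shift_map A) y)) nN) => j.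
  by rewrite mul0r.
apply: (@le_trans _ _ (\sum_(j < N) \sum_(k < N | (j <= k)%N)
   lip_seq j * (theta ^+ (k - j) * (x k != y k)%:R))).
  apply: ler_sum => j _; rewrite -mulr_sumr ler_wpM2l ?lip_seq_ge0 //.
  apply: le_trans (dtheta_sum (N := (N - j)%N) _) _.
    by move=> i ji; rewrite !iter_shift; apply: xy; rewrite -leq_subLR.
  rewrite -(big_geq_mkord j N xpredT (fun k => theta ^+ (k - j) * (x k != y k)%:R)).
  have -> : \sum_(j <= k < N) theta ^+ (k - j) * (x k != y k)%:R =
      \sum_(i < N - j) theta ^+ (i + j - j) * (x (i + j)%N != y (i + j)%N)%:R.
    by rewrite -{1}[nat_of_ord j]add0n big_addn big_mkord.
  by apply: ler_sum => i _; rewrite addnK !iter_shift addnC.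
rewrite (exchange_big_dep xpredT) //=; apply: ler_sum => k _.
rewrite /causal_conv mulr_suml.
rewrite (big_ord_widen_cond N xpredT (fun j => theta ^+ (k - j) * lip_seq j * (x k != y k)%:R)) //=.
by apply: ler_sum => j _; rewrite mulrCA mulrA.
Qed.

Lemma sum_conv_lip N : (n <= N)%N ->
  \sum_(k < N) causal_conv (fun s => theta ^+ s) lip_seq k ^+ 2 <=
  (1 - theta) ^- 2 * \sum_(j < n) lipschitz_constant theta K j ^+ 2.
Proof.
move=> nN.
have -> : \sum_(j < n) lipschitz_constant theta K j ^+ 2 = \sum_(j < N) lip_seq j ^+ 2.
  by apply: (sum_lip_seq (g := fun _ l => l ^+ 2) nN) => _; rewrite expr0n.
rewrite -exprVn; apply: sum_conv_sqr_le => [s|S]; first by rewrite exprn_ge0.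
have t1 : 0 < 1 - theta by rewrite subr_gt0.
rewrite -[leRHS]mul1r ler_pdivlMr // mulrC.
have -> : (1 - theta) * \sum_(s < S) theta ^+ s = 1 - theta ^+ S.
  by rewrite -[in RHS](expr1n R S) subrXX; congr (_ * _); apply: eq_bigr => i _;
    rewrite expr1n mul1r.
by rewrite lerBlDr lerDl exprn_ge0.
Qed.

Lemma causal_conv_lip_ge0 k : 0 <= causal_conv (fun s => theta ^+ s) lip_seq k.
Proof.
by apply: sumr_ge0 => j _; rewrite mulr_ge0 ?lip_seq_ge0 ?exprn_ge0.
Qed.

End LipschitzObservable.

(** * The concentration inequality for [mu] *)

Lemma glue_tail (A : pointedType) (I : finType) (d : I -> A) n (w : word I n) y i :
  glue d w y (n + i)%N = y i.
Proof. by elim: n w => [|n IH] w //; rewrite addSn /= IH. Qed.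

Theorem corollary3p2 (R : realType) (A : pointedType)
    (Afin : finite_set [set: A])
    (theta : R) (theta_gt0 : 0 < theta) (theta_lt1 : theta < 1)
    (phi : Omega A -> R) (phi_cont : continuous phi)
    (phi_var : exists2 alpha : R, 2 < alpha &
      potential_var phi =O_\oo (fun n : nat => n%:R `^ (- alpha)))
    (mu : probability (Omega A) R) (mu_eq : equilibrium_state phi mu) :
  exists2 C : R, 0 < C &
    forall (n : nat) (K : ('I_n -> Omega A) -> R), (1 <= n)%N ->
      separately_lipschitz theta K ->
      (\int[mu]_x (expR (K (orbit_segment n x)))%:E <=
       (expR (\int[mu]_x K (orbit_segment n x))%R *
        expR (C * \sum_(j < n) lipschitz_constant theta K j ^+ 2))%:E)%E.
Proof.
have [k [d [e [de ed]]]] := finite_alphabet Afin.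
have [rem [tl [phi_rem rem_ge0 rem_tl tl_ge0 rem_cvg0]]] :=
  potential_tail Afin phi_cont phi_var.
pose y0 : Omega A := point.
have press := equilibrium_pressure_ge de ed phi_rem rem_ge0 rem_cvg0 y0 mu_eq.
have conc := finite_range_concentration ed phi_rem rem_ge0 rem_tl tl_ge0 rem_cvg0
  mu_eq.1 press.
pose E := expR (2 * tl 0%N) ^+ 2.
have t1 : 0 < 1 - theta by rewrite subr_gt0.
(* [2] is the constant of [expR_le_addexp], [E] the squared bound on the expected number of
   renewals, and [(1 - theta) ^- 2] the price of passing from Lipschitz constants to letters. *)
exists (2 * (E * (1 - theta) ^- 2)).
  by rewrite !mulr_gt0 ?exprn_gt0 ?invr_gt0 ?exprn_gt0 ?expR_gt0.
move=> n K _ K_lip; rewrite -expRD.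
set V := 2 * _ * _.
pose F (x : Omega A) : R := K (orbit_segment n x).
pose SL := \sum_(j < n) lipschitz_constant theta K j.
have om_cvg : (fun m : nat => SL * theta ^+ m) @ \oo --> (0 : R).
  rewrite -(mulr0 SL); apply: cvgM; first exact: cvg_cst.
  by apply: cvg_expr; rewrite gtr0_norm.
have mF : measurable_fun setT F.
  apply: (measurable_fun_agree (om := fun N => SL * theta ^+ (N - n)%N)).
    by rewrite -(cvg_shiftn n); under eq_fun do rewrite addnK.
  by move=> N u v; exact: orbit_modulus.
have meF : measurable_fun setT (expR \o F) by exact: measurableT_comp.
(* Letters from position [n + m] on are frozen; the error [SL * theta ^+ m] enters twice, once in
   the exponential and once in the mean. *)
have bound m : (\int[mu]_x (expR (F x))%:E <=
    (expR ((\int[mu]_x F x)%R + V + 2 * (SL * theta ^+ m)))%:E)%E.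
  pose N := (n + m)%N; have nN : (n <= N)%N by exact: leq_addr.
  set om := SL * theta ^+ m.
  have FN_om u v : agree N u v -> F u - F v <= om.
    by move=> /(orbit_modulus theta_gt0 theta_lt1 K_lip); rewrite /N addKn.
  pose FN x := F (glue d (code e N x) y0).
  pose delta := causal_conv (fun s => theta ^+ s) (lip_seq theta K).
  have FN_delta u v : FN u - FN v <= \sum_(j < N) delta j * (u j != v j)%:R.
    rewrite /FN /F.
    apply: le_trans (orbit_hamming theta_gt0 K_lip nN _) _.
      by move=> i Ni; rewrite -(subnKC Ni) !glue_tail.
    apply: ler_sum => j _; rewrite -/(delta j).
    by rewrite -!(agree_glue_code ed _ y0).
  have delta_ge0 j : 0 <= delta j by exact: causal_conv_lip_ge0.
  have intFN : (\int[mu]_x FN x)%R = wmean d e mu y0 N F.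
    by rewrite /Rintegral (integral_code (n := N) e mu (fun w => F (glue d w y0))).2.
  have intE : (\int[mu]_x expR (FN x))%R = wmean d e mu y0 N (expR \o F).
    by rewrite /Rintegral (integral_code (n := N) e mu (fun w => expR (F (glue d w y0)))).2.
  have h1 : wmean d e mu y0 N (expR \o F) <= expR ((\int[mu]_x F x)%R + om + V).
    rewrite -intE; apply: le_trans (conc N FN delta delta_ge0 FN_delta) _.
    rewrite ler_expR; apply: lerD.
      have := Rintegral_wmean ed mu y0 mF FN_om.
      by rewrite intFN ler_norml => /andP[? _]; lra.
    rewrite /V -mulrA ler_pM2l // -mulrA ler_wpM2l ?exprn_ge0 ?expR_ge0 //.
    by apply: sum_conv_lip => //; exact: leqW.
  apply: (@le_trans _ _ (\int[mu]_x (expR (F (glue d (code e N x) y0)) * expR om)%:E)%E).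
    apply: ge0_le_integral => //.
    - exact/measurable_EFinP.
    - have := (integral_code (n := N) e mu (fun w => expR (F (glue d w y0)) * expR om)).1.
      by case/integrableP.
    - move=> x _; rewrite lee_fin -expRD ler_expR -lerBlDl.
      by apply: FN_om; exact: agree_glue_code.
  rewrite (integral_code (n := N) e mu (fun w => expR (F (glue d w y0)) * expR om)).2 lee_fin.
  under eq_bigr do rewrite mulrA.
  rewrite -mulr_suml; apply: le_trans (ler_wpM2r (expR_ge0 _) h1) _.
  by rewrite -expRD ler_expR; lra.
have I0 : (0 <= \int[mu]_x (expR (F x))%:E)%E.
  by apply: integral_ge0 => x _; rewrite lee_fin expR_ge0.
(* The bound at [m = 0] shows that the integral is finite, so the limit in [m] is taken among real
   numbers. *)
rewrite -[X in (X <= _)%E]fineK; last first.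
  by rewrite ge0_fin_numE //; apply: le_lt_trans (bound 0%N) _; rewrite ltry.
rewrite lee_fin.
set Y := (X in _ <= expR X).
have lim : (fun m : nat => expR (Y + 2 * (SL * theta ^+ m))) @ \oo --> expR Y.
  apply: continuous_cvg; first exact: continuous_expR.
  rewrite -[X in _ --> X]addr0; apply: cvgD; first exact: cvg_cst.
  by rewrite -(mulr0 2); apply: cvgM => //; exact: cvg_cst.
rewrite -(cvg_lim (@norm_hausdorff _ R) lim); apply: limr_ge.
  by apply/cvg_ex; eexists; exact: lim.
apply: nearW => m; rewrite -lee_fin fineK; first exact: bound.
by rewrite ge0_fin_numE //; apply: le_lt_trans (bound 0%N) _; rewrite ltry.
Qed.
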